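(* There exist constants $C>0$ and $\omega>0$ such that for all $u^0\in\mathcal{H}$ the solution of system $(S)$ with initial datum $u^0$ satisfies $$E(t)\le C\,e^{-\omega t}\,\|u^0\|_{\mathcal{H}}^2,\qquad\forall\,t>0.$$
   Context: Let $N\ge1$ be an integer and $\rho_0,\dots,\rho_{N-1}>0$ constants. System $(S)$ is, for complex-valued unknowns $u_j(t,x)$, $x\in(j,j+1)$, $t\in(0,\infty)$: $$\begin{cases}\partial_tu_j+i\rho_j\partial_x^2u_j=0\text{ on }(0,\infty)\times(j,j+1), & j=0,\dots,N-1,\\ \rho_0\partial_xu_0(t,0)=i\,u_0(t,0),\quad u_{N-1}(t,N)=0,\\ u_{j-1}(t,j)=u_j(t,j), & j=1,\dots,N-1,\\ -\rho_{j-1}\partial_xu_{j-1}(t,j)+\rho_j\partial_xu_j(t,j)=0, & j=1,\dots,N-1,\\ u_j(0,x)=u_j^0(x), & j=0,\dots,N-1.\end{cases}$$ Let $\mathcal{H}=\prod_{j=0}^{N-1}L^2(j,j+1)$ with inner product $\langle u,\tilde u\rangle_{\mathcal{H}}=\sum_{j=0}^{N-1}\int_j^{j+1}u_j\overline{\tilde u_j}\,dx$. Let $\mathcal{A}u=(-i\rho_j\partial_x^2u_j)_{0\le j\le N-1}$ with domain $\mathcal{D}(\mathcal{A})$ the set of $u\in\prod_{j=0}^{N-1}H^2(j,j+1)$ such that $\rho_0\partial_xu_0(0)=i\,u_0(0)$, $u_{N-1}(N)=0$, and $u_{j-1}(j)=u_j(j)$, $\rho_{j-1}\partial_xu_{j-1}(j)=\rho_j\partial_xu_j(j)$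 for $j=1,\dots,N-1$. The operator $\mathcal{A}$ generates a $C_0$-semigroup of contractions on $\mathcal{H}$; the solution of $(S)$ for $u^0\in\mathcal{H}$ is the (mild) solution $u\in C([0,\infty),\mathcal{H})$ of $u'=\mathcal{A}u$, $u(0)=u^0$. The energy is $E(t)=\frac12\sum_{j=0}^{N-1}\int_j^{j+1}|u_j(t,x)|^2dx$. *)

(* Defs.v *)
From HB Require Import structures.
From mathcomp Require Import all_boot all_order all_algebra.
From mathcomp Require Import complex.
From mathcomp Require Import all_classical all_reals all_analysis.
Import Order.TTheory GRing.Theory Num.Theory.
Import numFieldNormedType.Exports.

Set Implicit Arguments.
Unset Strict Implicit.
Unset Printing Implicit Defensive.

Local Open Scope classical_set_scope.
Local Open Scope complex_scope.
Local Open Scope ring_scope.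

(* A class in L^2(a,b) is represented by any of its Borel members R -> R[i];
   the values outside ]a, b[ play no role. *)
Section interval.
Context {R : realType}.
Implicit Types (a b : R) (f g : R -> R[i]) (phi : R -> R).

Definition cint a b f : R[i] :=
  Rintegral lebesgue_measure `]a, b[ (fun x => complex.Re (f x))
  +i* Rintegral lebesgue_measure `]a, b[ (fun x => complex.Im (f x)).

Definition L2 a b f : Prop :=
  [/\ measurable_fun `]a, b[ (fun x => complex.Re (f x)),
      measurable_fun `]a, b[ (fun x => complex.Im (f x)) &
      (\int[lebesgue_measure]_(x in `]a, b[) ((Normc.normc (f x) ^+ 2)%:E)
         < +oo)%E].

Definition ae_eq_on a b f g : Prop :=
  {ae lebesgue_measure, forall x : R, x \in `]a, b[ -> f x = g x}.

(* Test functions are C^1 with compact support in ]a, b[, the usual choice for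
   one-dimensional Sobolev spaces (Brezis, Functional Analysis, Sect. 8.2).
   Testing against real functions suffices, the pairing being linear over
   R[i]. *)
Definition C1c a b phi : Prop :=
  [/\ forall x, derivable phi x 1, continuous (derive1 phi) &
      exists c d, [/\ a < c, d < b &
        forall x, x \notin `[c, d] -> phi x = 0]].

Definition is_wderiv a b f g : Prop :=
  L2 a b g /\
  forall phi, C1c a b phi ->
    cint a b (fun x => f x * (derive1 phi x)%:C) =
    - cint a b (fun x => g x * (phi x)%:C).

Definition H1 a b f : Prop := L2 a b f /\ exists g, is_wderiv a b f g.

(* A representative of the weak derivative; meaningful only if H1 a b f. *)
Definition wderiv a b f : R -> R[i] :=
  xget (fun=> 0) [set g | is_wderiv a b f g].

Definition H2 a b f : Prop := H1 a b f /\ H1 a b (wderiv a b f).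

(* The representative of f that is continuous on [a, b], for H1 a b f and
   a < b; its values at a and b are the boundary values of f. *)
Definition crep a b f : R -> R[i] :=
  xget (fun=> 0) [set g |
    [/\ {within `[a, b], continuous (fun x => complex.Re (g x))},
        {within `[a, b], continuous (fun x => complex.Im (g x))} &
        ae_eq_on a b f g]].

End interval.

Section network.
Context {R : realType} (N : nat).
Local Notation field := ('I_N -> R -> R[i]).
Implicit Types (u v h : field) (j : 'I_N).

Definition inH u : Prop := forall j, L2 j%:R j.+1%:R (u j).

Definition eqH u v : Prop := forall j, ae_eq_on j%:R j.+1%:R (u j) (v j).

Definition innerH u v : R[i] :=
  \sum_(j < N) cint j%:R j.+1%:R (fun x => u j x * ((v j x)^*)%C).

Definition normH u : R := Num.sqrt (complex.Re (innerH u u)).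

Definition energy u : R :=
  2^-1 * \sum_(j < N) Rintegral lebesgue_measure `]j%:R, j.+1%:R[
           (fun x => Normc.normc (u j x) ^+ 2).

Definition dx u : field := fun j => wderiv j%:R j.+1%:R (u j).

Definition bval u j : R -> R[i] := crep j%:R j.+1%:R (u j).

Variable rho : 'I_N -> R.

Definition opA u : field := fun j x => - ('i)%C * (rho j)%:C * dx (dx u) j x.

Definition domA u : Prop :=
  [/\ forall j, H2 j%:R j.+1%:R (u j),
      forall j, j = 0%N :> nat ->
        (rho j)%:C * bval (dx u) j 0 = ('i)%C * bval u j 0,
      forall j, j.+1 = N -> bval u j N%:R = 0,
      forall j k : 'I_N, k = j.+1 :> nat -> bval u j k%:R = bval u k k%:R &
      forall j k : 'I_N, k = j.+1 :> nat ->
        (rho j)%:C * bval (dx u) j k%:R = (rho k)%:C * bval (dx u) k k%:R].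

(* v is the integral of u over [0, t], as an H-valued (weak) integral. *)
Definition integralH (u : R -> field) (t : R) v : Prop :=
  inH v /\
  forall h, inH h -> innerH v h = cint 0 t (fun s => innerH (u s) h).

(* Mild solution of u' = A u, u(0) = u0 (Engel-Nagel, Def. II.6.3):
   u is in C([0, oo), H) and, for all t >= 0, the integral of u over [0, t]
   is in D(A) and u(t) = u0 + A (integral of u over [0, t]).
   At t = 0 this gives u(0) = u0. *)
Definition mild_solution (u0 : field) (u : R -> field) : Prop :=
  [/\ forall t, 0 <= t -> inH (u t),
      forall t, 0 <= t ->
        normH (fun j x => u s j x - u t j x)
          @[s --> within [set s | 0 <= s] (nbhs t)] --> (0 : R) &
      forall t, 0 <= t -> exists v,
        [/\ integralH u t v, domA v &
            eqH (u t) (fun j x => u0 j x + opA v j x)]].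

End network.

(* Main.v *)
(* The decay rate comes from a bound |U| <= M |i beta U - A U|, uniform in the real
   number beta, proved without inverting the operator. Below the spectral gap it is
   the Poincare inequality for fields vanishing at x = N. Above it, the sidewise energy
   rho |U'|^2 + beta |U|^2 has x-derivative controlled by the residual i beta U - A U,
   so it propagates from x = 0 across all the joints, and at x = 0 the boundary damping
   identity Re <A U, U> = - |U(0)|^2 bounds it. By dissipativity the bound persists
   for i beta replaced by any lambda with Re lambda >= 0.
     In place of the Fourier transform in time one discretizes: multiply the solution
   by a tent function vanishing at both ends of a time interval of length T, sample it
   with step h, and apply the resolvent bound to each mode of the finite Fourier
   transform, on which the implicit Euler quotient has symbol (1 - w^m) / h. Parseval
   and h -> 0 give T^2 |U(s + T)|^2 <= 32 M |U(s)|^2, hence a norm halved after a fixed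
   time. The argument needs classical solutions; it is applied to the increments
   v(t + d) - v(t) of the integral v of a mild solution u, and (v(t + d) - v(t)) / d
   tends to u(t). *)
From HB Require Import structures.
Require Import Defs.
From mathcomp Require Import all_boot all_order all_algebra.
From mathcomp Require Import complex zify ring lra cyclic separable cyclotomic.
From mathcomp Require Import all_classical all_reals all_analysis measurable_realfun.
Import Order.TTheory GRing.Theory Num.Theory.
Import numFieldNormedType.Exports.

Set Implicit Arguments.
Unset Strict Implicit.
Unset Printing Implicit Defensive.

(** * Integrals over bounded open intervals *)

Section integrals.
Context {R : realType}.
Local Open Scope classical_set_scope.
Local Open Scope ring_scope.
Local Notation mu := (@lebesgue_measure R).
Implicit Types (a b c d e x y : R) (f g F G : R -> R).

(** A point of H is here a function, not a class, and [wderiv] and [crep] pick representatives by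
    choice. The inner product is therefore only semidefinite, and the operator, which is not linear
    on representatives, is replaced by a linear relation between them. Integrals of curves in H are
    always tested against a fixed vector. The constant 32: the tent has slope at most 1, so it
    creates a source bounded by |U(s)| on a length T; on the middle half of the interval it is at
    least T/4, and there |U| is at least |U(s + T)| by contraction. Comparing (T/2) (T/4)^2 |U(s +
    T)|^2 with M T |U(s)|^2 gives the stated bound. Increments: a mild solution need not lie in the
    domain, and its integral v solves the inhomogeneous equation v' = A v + u0. Differences of v at
    two times cancel u0; they solve the homogeneous equation and have the continuous derivative u(t
    + d) - u(t). *)

Lemma ler_addgt0 (x y : R) : (forall e : R, 0 < e -> x <= y + e) -> x <= y.
Proof. by move=> H; apply/ler_addgt0Pr. Qed.

Definition itg a b f : R := \int[mu]_(x in `]a, b[) f x.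
Definition intg a b f : Prop := mu.-integrable `]a, b[ (EFin \o f).

Lemma itg_refl a f : itg a a f = 0.
Proof. by rewrite /itg set_itvoo0 Rintegral_set0. Qed.

Lemma eq_itg a b f g : (forall x, a < x < b -> f x = g x) -> itg a b f = itg a b g.
Proof. by move=> fg; apply: eq_Rintegral => x; rewrite inE /= in_itv /= => /fg. Qed.

Lemma intgS a b c d f : a <= c -> d <= b -> intg a b f -> intg c d f.
Proof.
move=> ac db; apply: integrableS => // x /=.
rewrite !in_itv /= => /andP[cx xd].
by rewrite (le_lt_trans ac cx) (lt_le_trans xd db).
Qed.

Lemma intgD a b f g : intg a b f -> intg a b g -> intg a b (fun x => f x + g x).
Proof. by move=> If Ig; have H := integrableD _ If Ig; exact: H. Qed.

Lemma intgB a b f g : intg a b f -> intg a b g -> intg a b (fun x => f x - g x).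
Proof. by move=> If Ig; have H := integrableB _ If Ig; exact: H. Qed.

Lemma intgZ a b (k : R) f : intg a b f -> intg a b (fun x => k * f x).
Proof. by move=> If; have H := integrableZl _ k If; exact: H. Qed.

Lemma intgN a b f : intg a b f -> intg a b (fun x => - f x).
Proof. by move=> If; exact: (@integrableN _ _ _ mu _ _ If). Qed.

Lemma intg_norm a b f : intg a b f -> intg a b (fun x => `|f x|).
Proof. by move=> If; exact: (@integrable_abse _ _ _ mu _ _ If). Qed.

Lemma intg_cst a b (k : R) : intg a b (fun=> k).
Proof.
have [ab|ba] := leP a b; last first.
  by rewrite /intg set_itv_ge ?bnd_simp -?leNgt ?(ltW ba) //; exact: integrable_set0.
apply: (@integrableS _ _ _ mu `[a, b]) => //.
  by apply: subset_itv; rewrite bnd_simp.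
by apply: continuous_compact_integrable; [exact: segment_compact|move=> x; exact: cvg_cst].
Qed.

Lemma itgD a b f g : intg a b f -> intg a b g ->
  itg a b (fun x => f x + g x) = itg a b f + itg a b g.
Proof. by move=> If Ig; rewrite /itg RintegralD. Qed.

Lemma itgB a b f g : intg a b f -> intg a b g ->
  itg a b (fun x => f x - g x) = itg a b f - itg a b g.
Proof. by move=> If Ig; rewrite /itg RintegralB. Qed.

Lemma itgZ a b (k : R) f : intg a b f -> itg a b (fun x => k * f x) = k * itg a b f.
Proof. by move=> If; rewrite /itg RintegralZl. Qed.

Lemma itgN a b f : intg a b f -> itg a b (fun x => - f x) = - itg a b f.
Proof.
move=> If; rewrite -mulN1r -itgZ //.
by apply: eq_itg => x _; rewrite mulN1r.
Qed.

Lemma itg_cst a b (k : R) : a <= b -> itg a b (fun=> k) = k * (b - a).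
Proof.
move=> ab; rewrite /itg Rintegral_cst //.
have := @lebesgue_measure_itv R `]a, b[ => /= ->.
rewrite lte_fin; case: ltgtP ab => //= -> _; by rewrite subrr.
Qed.

Lemma le_itg a b f g : intg a b f -> intg a b g ->
  (forall x, a < x < b -> f x <= g x) -> itg a b f <= itg a b g.
Proof.
move=> If Ig fg; apply: le_Rintegral => // x /=; rewrite in_itv /=; exact: fg.
Qed.

Lemma itg_ge0 a b f : (forall x, a < x < b -> 0 <= f x) -> 0 <= itg a b f.
Proof. by move=> f0; apply: Rintegral_ge0 => x /=; rewrite in_itv /=; exact: f0. Qed.

Lemma le_norm_itg a b f : intg a b f -> `|itg a b f| <= itg a b (fun x => `|f x|).
Proof. by move=> If; apply: le_normr_Rintegral. Qed.

Lemma itg_split a b c f : a <= c <= b -> intg a b f ->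
  itg a b f = itg a c f + itg c b f.
Proof.
move=> /andP[ac cb] If; rewrite /itg.
have [->|nac] := eqVneq a c; first by rewrite set_itvoo0 Rintegral_set0 add0r.
have [<-|ncb] := eqVneq c b; first by rewrite set_itvoo0 Rintegral_set0 addr0.
have {nac}ac : a < c by rewrite lt_neqAle nac.
have {ncb}cb : c < b by rewrite lt_neqAle ncb.
have := @Rintegral_itvB R f (BRight a) (BLeft b) c If.
rewrite !bnd_simp => /(_ (ltW ac) cb) <-.
rewrite [X in _ = X + _]Rintegral_itv_bndo_bndc; first by rewrite addrC subrK.
by apply: intgS If => //; exact: ltW.
Qed.

Lemma eq_itg_ae a b f g : {ae mu, forall x, x \in `]a, b[ -> f x = g x} ->
  measurable_fun `]a, b[ f ->
  measurable_fun `]a, b[ g -> itg a b f = itg a b g.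
Proof.
move=> fg mf mg; rewrite /itg /Rintegral; congr fine.
apply: ae_eq_integral => //; try exact/measurable_EFinP.
move: fg; apply: filterS; first exact: (ae_filter_ringOfSetsType mu).
move=> x /= H Dx; rewrite H // inE.
Qed.

Lemma intg_measurable a b f : intg a b f -> measurable_fun `]a, b[ f.
Proof. by move=> /integrableP[+ _]; move/measurable_EFinP. Qed.

Lemma intg_mulb a b f g (k : R) : measurable_fun `]a, b[ g ->
  (forall x, a < x < b -> `|g x| <= k) -> intg a b f -> intg a b (fun x => g x * f x).
Proof.
move=> mg gk If; apply: (le_integrable _ _ _ (intgZ k (intg_norm If))) => //.
  apply/measurable_EFinP; apply: measurable_funM => //; exact: intg_measurable.
move=> x /=; rewrite in_itv /= => axb; rewrite lee_fin normrM.
rewrite normrM normr_id ler_wpM2r // (le_trans (gk _ axb)) // ler_norm //.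
Qed.

Lemma intg_small a b f : intg a b f -> forall e, 0 < e ->
  exists2 d, 0 < d & forall x y, a <= x -> x <= y -> y <= b -> y - x < d ->
    itg x y (fun z => `|f z|) < e.
Proof.
move=> If e e0.
have Ir : mu.-integrable setT (EFin \o (f \_ `]a, b[)).
  rewrite -restrict_EFin; apply/integrable_restrict => //.
  by rewrite setTI.
have [d [d0 H]] := integral_normr_continuous Ir e0.
exists d => // x y ax xy yb yxd.
have := H `]x, y[%classic (measurable_itv _).
have := @lebesgue_measure_itv R `]x, y[ => /= ->.
rewrite lte_fin.
have -> : ((if (x < y)%R then y%:E - x%:E else 0) < d%:E)%E.
  by case: ifP => _; rewrite -?EFinB lte_fin.
move=> /(_ isT); congr (_ < _).
apply: eq_itg => z /andP[xz zy]; rewrite patchE ifT // inE /= in_itv /=.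
by rewrite (le_lt_trans ax) // (lt_le_trans zy).
Qed.

(** Adding the local bounds over a uniform partition of mesh below [d] telescopes to e (m b - m a),
    and [e] is arbitrary. This acts as a mean value inequality: [m] is an integral in the product
    rule and the identity for curves. *)
Lemma partition_le a b (H m : R -> R) : a <= b ->
  (forall e, 0 < e -> exists2 d, 0 < d & forall x y, a <= x -> x <= y -> y <= b ->
     y - x < d -> H y - H x <= e * (m y - m x)) -> H b <= H a.
Proof.
move=> ab He; rewrite -subr_le0; apply: ler_addgt0 => e e0.
rewrite add0r.
(* A positive bound for the total increment of [m], so that [e / c] makes sense. *)
pose c : R := `|m b - m a| + 1.
have c0 : 0 < c by rewrite ltr_wpDl.
have [d d0 Hd] := He (e / c) (divr_gt0 e0 c0).
have [n nd] : exists n : nat, (b - a) / n.+1%:R < d.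
  exists (Num.truncn ((b - a) / d)).
  rewrite ltr_pdivrMr // mulrC -ltr_pdivrMr //.
  exact: truncnS_gt.
pose t (k : nat) : R := a + k%:R * ((b - a) / n.+1%:R).
have n0 : (0 : R) < n.+1%:R by [].
have s0 : 0 <= (b - a) / n.+1%:R by rewrite divr_ge0 ?subr_ge0 // ltW.
have tb : t n.+1 = b by rewrite /t mulrC divfK ?lt0r_neq0 //; lra.
have ta : t 0%N = a by rewrite /t mul0r addr0.
have tS k : t k.+1 - t k = (b - a) / n.+1%:R by rewrite /t -natr1; ring.
have step k : (k < n.+1)%N -> H (t k.+1) - H (t k) <= e / c * (m (t k.+1) - m (t k)).
  move=> kn; apply: Hd.
  - by rewrite /t lerDl mulr_ge0.
  - by rewrite -subr_ge0 tS.
  - rewrite -tb -subr_ge0 /t opprD addrACA subrr add0r -mulrBl mulr_ge0 //.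
    by rewrite subr_ge0 ler_nat.
  - by rewrite tS.
have {}step k : (k <= n.+1)%N -> H (t k) - H a <= e / c * (m (t k) - m a).
  elim: k => [|k IH] kn; first by rewrite ta !subrr mulr0.
  have -> : H (t k.+1) - H a = (H (t k.+1) - H (t k)) + (H (t k) - H a) by ring.
  rewrite (le_trans (lerD (step k kn) (IH (ltnW kn)))) //.
  have -> : m (t k.+1) - m a = m (t k.+1) - m (t k) + (m (t k) - m a) by ring.
  by rewrite -mulrDr.
have := step n.+1 (leqnn _); rewrite tb => /le_trans; apply.
rewrite -[leRHS](divfK (lt0r_neq0 c0)) ler_wpM2l ?ltW ?divr_gt0 //.
by apply: le_lt_trans (ler_norm _) _; rewrite /c ltrDl.
Qed.

Lemma partition_rigidity a b (H m : R -> R) : a <= b ->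
  (forall e, 0 < e -> exists2 d, 0 < d & forall x y, a <= x -> x <= y -> y <= b ->
     y - x < d -> `|H y - H x| <= e * (m y - m x)) -> H b = H a.
Proof.
move=> ab He; apply/eqP; rewrite eq_le; apply/andP; split.
  apply: (partition_le (m := m) ab) => e /He[d d0 Hd]; exists d => // x y ax xy yb yx.
  exact: le_trans (ler_norm _) (Hd x y ax xy yb yx).
rewrite -lerN2; apply: (partition_le (H := fun x => - H x) (m := m) ab) => e /He[d d0 Hd].
exists d => // x y ax xy yb yx; rewrite opprK addrC.
by apply: le_trans (ler_norm _) _; rewrite distrC; exact: Hd.
Qed.

End integrals.

(** * Absolutely continuous functions and their product rule *)

Section absolute_continuity.
Context {R : realType}.
Local Open Scope classical_set_scope.
Local Open Scope ring_scope.
Local Notation mu := (@lebesgue_measure R).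
Implicit Types (a b c d e x y : R) (f g F G : R -> R).

(** Absolute continuity in the form of the fundamental theorem of calculus. The density is an
    explicit argument, so that derivatives known only almost everywhere can be combined as
    functions. *)
Definition ac a b F f : Prop :=
  intg a b f /\ forall x, a <= x <= b -> F x = F a + itg a x f.

Lemma ac_sub a b F f x y : ac a b F f -> a <= x -> x <= y -> y <= b ->
  F y - F x = itg x y f.
Proof.
move=> [If H] ax xy yb.
rewrite (H y) ?(le_trans ax) //= (H x) ?ax ?(le_trans xy) //=.
rewrite (@itg_split _ a y x) ?ax ?xy //; first by ring.
exact: intgS If.
Qed.

Lemma ac_unif a b F f : ac a b F f -> forall e, 0 < e ->
  exists2 d, 0 < d & forall x y, a <= x <= b -> a <= y <= b -> `|y - x| < d ->
    `|F y - F x| < e.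
Proof.
move=> H e e0; have [d d0 Hd] := intg_small H.1 e0.
exists d => //.
have key x y : a <= x -> x <= y -> y <= b -> y - x < d -> `|F y - F x| < e.
  move=> ax xy yb yx; rewrite (ac_sub H) //.
  apply: le_lt_trans (Hd _ _ ax xy yb yx); apply: le_norm_itg.
  exact: intgS H.1.
move=> x y /andP[ax xb] /andP[ay yb].
have [xy|yx] := leP x y => xyd.
  by apply: key => //; apply: le_lt_trans xyd; exact: ler_norm.
rewrite distrC; apply: key => //; first exact: ltW.
by rewrite distrC in xyd; apply: le_lt_trans xyd; exact: ler_norm.
Qed.

Lemma ac_continuous a b F f : ac a b F f -> {within `[a, b], continuous F}.
Proof.
move=> H; apply/subspace_continuousP => x /=; rewrite in_itv /= => axb.
apply/cvgrPdist_lt => e e0; have [d d0 Hd] := ac_unif H e0.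
rewrite near_withinE; apply: filterS (nbhsx_ballx x d d0) => y xy /=.
by rewrite in_itv /= distrC => ayb; apply: Hd => //; rewrite distrC.
Qed.

Lemma ac_bounded a b F f x : ac a b F f -> a <= x <= b ->
  `|F x| <= `|F a| + itg a b (fun z => `|f z|).
Proof.
move=> H axb; case/andP: (axb) => ax xb.
have If := intg_norm H.1.
rewrite (H.2 _ axb) (le_trans (ler_normD _ _)) // lerD2l.
rewrite (le_trans (le_norm_itg (intgS _ _ H.1))) //.
by rewrite (itg_split axb If) lerDl; apply: itg_ge0.
Qed.

Lemma ac_measurable a b F f : ac a b F f -> measurable_fun `]a, b[ F.
Proof.
move=> /ac_continuous H.
apply: subspace_continuous_measurable_fun => //.
apply: continuous_subspaceW H; exact: subset_itv_oo_cc.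
Qed.

Lemma intg_acM a b F f g : ac a b F f -> intg a b g -> intg a b (fun x => F x * g x).
Proof.
move=> H Ig; apply: (intg_mulb (ac_measurable H) _ Ig) => x /andP[ax xb].
by apply: (ac_bounded H); rewrite !ltW.
Qed.

Lemma intg_ac a b F f : ac a b F f -> intg a b F.
Proof.
move=> H; have := intg_acM H (intg_cst a b 1).
by congr (intg _ _ _); apply/funext => x; rewrite mulr1.
Qed.

Lemma acD a b F f G g : ac a b F f -> ac a b G g ->
  ac a b (fun x => F x + G x) (fun x => f x + g x).
Proof.
move=> HF HG; split; first exact: intgD HF.1 HG.1.
move=> x /andP[ax xb]; rewrite itgD; [|exact: intgS (lexx _) xb HF.1|exact: intgS (lexx _) xb HG.1].
by rewrite HF.2 ?ax // HG.2 ?ax //; ring.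
Qed.

Lemma acZ a b (k : R) F f : ac a b F f -> ac a b (fun x => k * F x) (fun x => k * f x).
Proof.
move=> HF; split; first exact: intgZ HF.1.
move=> x /andP[ax xb]; rewrite itgZ; last exact: intgS (lexx _) xb HF.1.
by rewrite HF.2 ?ax //; ring.
Qed.

Lemma ac_cst a b (k : R) : ac a b (fun=> k) (fun=> 0).
Proof.
split; first exact: intg_cst.
by move=> x /andP[ax xb]; rewrite itg_cst //; ring.
Qed.

Lemma eq_ac a b F f F' f' : (forall x, a <= x <= b -> F x = F' x) ->
  (forall x, a < x < b -> f x = f' x) -> a <= b -> ac a b F f -> ac a b F' f'.
Proof.
move=> HF Hf ab [If H]; split.
  apply: eq_integrable If => // x; rewrite inE /= in_itv /= => /Hf ->//.
move=> x axb; rewrite -HF // -HF ?lexx ?ab // H //; congr (_ + _).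
by apply: eq_itg => z /andP[az zx]; apply: Hf; rewrite az (lt_le_trans zx) //; case/andP: axb.
Qed.

Lemma ac_primitive a b f : intg a b f -> ac a b (fun x => itg a x f) f.
Proof. by move=> If; split=> // x _; rewrite itg_refl add0r. Qed.

(** By uniform continuity of F and G, the defect of the formula changes over a short interval by at
    most [e] times the integral of |f| + |g|; [partition_rigidity] then makes it constant. *)
Lemma acM a b F f G g : ac a b F f -> ac a b G g ->
  ac a b (fun x => F x * G x) (fun x => F x * g x + G x * f x).
Proof.
move=> HF HG.
have I1 := intgD (intg_acM HF HG.1) (intg_acM HG HF.1).
split => // x0 /andP[ax0 x0b].
pose m x := itg a x (fun z => `|f z| + `|g z|).
pose H x := F x * G x - itg a x (fun x => F x * g x + G x * f x).
suff : H x0 = H a by rewrite /H itg_refl => E; lra.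
apply: (partition_rigidity (m := m) ax0) => e e0.
have [d1 d10 Hd1] := ac_unif HF e0.
have [d2 d20 Hd2] := ac_unif HG e0.
exists (Num.min d1 d2); first by rewrite lt_min d10.
move=> x y ax xy yx0; rewrite lt_min => /andP[yx1 yx2].
have xx0 := le_trans xy yx0.
have xb := le_trans xx0 x0b.
have yb := le_trans yx0 x0b.
have ay := le_trans ax xy.
have Ifx : intg x y f by apply: intgS HF.1.
have Igx : intg x y g by apply: intgS HG.1.
have IFg : intg x y (fun z => F z * g z + G z * f z) by apply: intgS I1.
have In : intg x y (fun z => `|f z| + `|g z|) by apply: intgD; apply: intg_norm.
have IN : intg a y (fun z => `|f z| + `|g z|).
  by apply: (@intgS _ a b) => //; apply: intgD; apply: intg_norm; [exact: HF.1|exact: HG.1].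
have -> : m y - m x = itg x y (fun z => `|f z| + `|g z|).
  by rewrite /m (@itg_split _ a y x) ?ax //; ring.
have -> : H y - H x = itg x y (fun z => (F y * g z + G x * f z) - (F z * g z + G z * f z)).
  rewrite itgB //; last by apply: intgD; apply: intgZ.
  rewrite itgD ?itgZ //; try exact: intgZ.
  rewrite -(ac_sub HF) // -(ac_sub HG) //.
  rewrite /H (@itg_split _ a y x _) ?ax //; first by ring.
  exact: intgS I1.
have I2 : intg x y (fun z => (F y * g z + G x * f z) - (F z * g z + G z * f z)).
  by apply: intgB => //; apply: intgD; apply: intgZ.
rewrite (le_trans (le_norm_itg I2)) // -itgZ //.
apply: le_itg; [exact: intg_norm|exact: intgZ|].
move=> z /andP[xz zy].
have -> : F y * g z + G x * f z - (F z * g z + G z * f z) =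
   (F y - F z) * g z + (G x - G z) * f z by ring.
rewrite (le_trans (ler_normD _ _)) // !normrM mulrDr addrC.
have az : a <= z by rewrite (le_trans ax) // ltW.
have zb : z <= b by rewrite (le_trans _ yb) // ltW.
apply: lerD; rewrite ler_wpM2r // ltW //.
  apply: Hd2; rewrite ?az ?ax //.
  by rewrite ltr0_norm ?subr_lt0 // opprB (lt_trans _ yx2) // ltrD2r.
apply: Hd1; rewrite ?az ?ay //.
by rewrite gtr0_norm ?subr_gt0 // (lt_trans _ yx1) // ltrD2l ltrN2.
Qed.

End absolute_continuity.

(** * Spline test functions and the du Bois-Reymond lemma *)

Section du_bois_reymond.
Context {R : realType}.
Local Open Scope classical_set_scope.
Local Open Scope ring_scope.
Local Notation mu := (@lebesgue_measure R).
Implicit Types (a b c d e r x y z : R) (f g k F G phi : R -> R).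

(** A quadratic remainder bound handles every point in the same way, including the knots of the
    piecewise polynomials below. *)
Lemma is_derive_quad f x l (C : R) :
  (forall z, `|f z - f x - l * (z - x)| <= C * (z - x) ^+ 2) -> is_derive x 1 f l.
Proof.
move=> H; apply/is_derive1_caratheodory.
exists (fun z => if z == x then l else (f z - f x) / (z - x)); split.
- move=> z; case: eqVneq => [->|zx]; first by rewrite !subrr mulr0.
  by rewrite divfK // subr_eq0.
- apply/cvgrPdist_le => e e0; rewrite eqxx.
  have C0 : 0 < `|C| + 1 by rewrite ltr_wpDl.
  apply: filterS (nbhsx_ballx x _ (divr_gt0 e0 C0)) => z xz /=.
  case: ifPn => [_|zx]; first by rewrite subrr normr0 ltW.
  have zx0 : 0 < `|z - x| by rewrite normr_gt0 subr_eq0.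
  rewrite distrC -(ler_pM2r zx0) -normrM mulrBl divfK ?subr_eq0 //.
  apply: le_trans (H z) _.
  rewrite -real_normK ?num_real // expr2 mulrA ler_wpM2r //.
  move: xz; rewrite /ball /= distrC ltr_pdivlMr // => /ltW; apply: le_trans.
  by rewrite mulrC ler_wpM2l // (le_trans (ler_norm _)) // lerDl.
- by rewrite eqxx.
Qed.

Lemma lipschitz1_continuous f (C : R) :
  (forall x y, `|f y - f x| <= C * `|y - x|) -> continuous f.
Proof.
move=> H x; apply/cvgrPdist_le => e e0.
have C0 : 0 < `|C| + 1 by rewrite ltr_wpDl.
apply: filterS (nbhsx_ballx x _ (divr_gt0 e0 C0)) => z xz /=.
apply: le_trans (H _ _) _; move: xz; rewrite /ball /= ltr_pdivlMr // => /ltW; apply: le_trans.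
by rewrite mulrC ler_wpM2l // (le_trans (ler_norm _)) // lerDl.
Qed.

Lemma C1_ac a b f : a <= b -> (forall x, derivable f x 1) -> continuous (derive1 f) ->
  ac a b f (derive1 f).
Proof.
move=> ab df cf.
have If x y : intg x y (derive1 f).
  have [xy|yx] := leP x y; last first.
    by rewrite /intg set_itv_ge ?bnd_simp -?leNgt ?(ltW yx) //; exact: integrable_set0.
  apply: (@integrableS _ _ _ mu `[x, y]) => //.
    by apply: subset_itv; rewrite bnd_simp.
  apply: continuous_compact_integrable; first exact: segment_compact.
  exact: continuous_subspaceT.
split=> // x /andP[ax _].
move: ax; rewrite le_eqVlt => /predU1P[<-|ax]; first by rewrite itg_refl addr0.
have cvf : continuous f.
  by move=> z; apply: differentiable_continuous; apply/derivable1_diffP.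
have := @continuous_FTC2 R (derive1 f) f a x ax.
rewrite /itg (@Rintegral_itv_bndo_bndc _ (BRight a) x _ (If a x)).
rewrite (@Rintegral_itv_obnd_cbnd _ a (BRight x)); last first.
  apply: (@integrableS _ _ _ mu `[a, x]) => //.
    by apply: subset_itv; rewrite bnd_simp.
  apply: continuous_compact_integrable; first exact: segment_compact.
  exact: continuous_subspaceT.
move=> H; rewrite /Rintegral H.
- by rewrite -EFinB; change (f x = f a + (f x - f a)); rewrite addrC subrK.
- exact: continuous_subspaceT.
- by split=> //; [apply: cvg_at_right_filter|apply: cvg_at_left_filter]; exact: cvf.
- by [].
Qed.

Definition pos x : R := Num.max 0 x.
(** The C^1 primitive of [pos]. *)
Definition spl x : R := pos x ^+ 2 / 2.

Lemma posP x : (0 <= x /\ pos x = x) \/ (x < 0 /\ pos x = 0).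
Proof. by rewrite /pos; case: (leP 0 x); [left|right]. Qed.

Lemma spl_quad x z h : h = z - x -> `|spl z - spl x - pos x * h| <= h ^+ 2.
Proof.
move=> ->; rewrite /spl ler_norml; have Q := sqr_ge0 (z - x).
have Qx := sqr_ge0 x; have Qz := sqr_ge0 z.
case: (posP x) => -[hx ->]; case: (posP z) => -[hz ->].
- by apply/andP; split; nra.
- have xz : 0 <= x * - z by rewrite mulr_ge0 // oppr_ge0 ltW.
  by apply/andP; split; nra.
- have xz : 0 <= - x * z by rewrite mulr_ge0 // oppr_ge0 ltW.
  by apply/andP; split; nra.
- by apply/andP; split; nra.
Qed.

Lemma pos_lip x z h : h = z - x -> `|pos z - pos x| <= `|h|.
Proof.
move=> ->.
case: (posP x) => -[hx ->]; case: (posP z) => -[hz ->] //.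
- by rewrite sub0r normrN [leRHS]distrC !ger0_norm; lra.
- by rewrite subr0 !ger0_norm; lra.
- by rewrite subrr normr0.
Qed.

(** A second difference of [pos]: the tent centred at [c] with half-width and height both equal to
    [r], hence of mass [r ^+ 2]. *)
Definition hat c r y : R := pos (y - c + r) - 2 * pos (y - c) + pos (y - c - r).
(* the C^1 primitive of the hat function, a second difference of [spl] *)
Definition bump c r y : R := spl (y - c + r) - 2 * spl (y - c) + spl (y - c - r).

Lemma bump_quad c r y z :
  `|bump c r z - bump c r y - hat c r y * (z - y)| <= 4 * (z - y) ^+ 2.
Proof.
have := @spl_quad (y - c + r) (z - c + r) (z - y).
have := @spl_quad (y - c) (z - c) (z - y).
have := @spl_quad (y - c - r) (z - c - r) (z - y).
move=> /(_ ltac:(ring)) H1 /(_ ltac:(ring)) H2 /(_ ltac:(ring)) H3.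
rewrite !ler_norml in H1 H2 H3 *.
by rewrite /bump /hat; case/andP: H1; case/andP: H2; case/andP: H3 => *; apply/andP; split; lra.
Qed.

Lemma hat_lip c r y z : `|hat c r z - hat c r y| <= 4 * `|z - y|.
Proof.
have := @pos_lip (y - c + r) (z - c + r) (z - y).
have := @pos_lip (y - c) (z - c) (z - y).
have := @pos_lip (y - c - r) (z - c - r) (z - y).
move=> /(_ ltac:(ring)) H1 /(_ ltac:(ring)) H2 /(_ ltac:(ring)) H3.
rewrite !ler_norml in H1 H2 H3 *.
by rewrite /hat; case/andP: H1; case/andP: H2; case/andP: H3 => *; apply/andP; split; lra.
Qed.

Lemma bump_left c r y : 0 <= r -> y <= c - r -> bump c r y = 0.
Proof.
move=> r0 yc; rewrite /bump /spl.
case: (posP (y - c + r)) => -[? ->]; case: (posP (y - c)) => -[? ->];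
case: (posP (y - c - r)) => -[? ->]; nra.
Qed.

Lemma bump_right c r y : 0 <= r -> c + r <= y -> bump c r y = r ^+ 2.
Proof.
move=> r0 yc; rewrite /bump /spl.
case: (posP (y - c + r)) => -[? ->]; case: (posP (y - c)) => -[? ->];
case: (posP (y - c - r)) => -[? ->]; nra.
Qed.

Lemma hat_out c r y : 0 <= r -> (y <= c - r \/ c + r <= y) -> hat c r y = 0.
Proof.
move=> r0 [] yc; rewrite /hat;
case: (posP (y - c + r)) => -[? ->]; case: (posP (y - c)) => -[? ->];
case: (posP (y - c - r)) => -[? ->]; lra.
Qed.

Lemma hat_le c r y : 0 <= r -> `|hat c r y| <= r.
Proof.
move=> r0; rewrite ler_norml /hat.
by case: (posP (y - c + r)) => -[? ->]; case: (posP (y - c)) => -[? ->];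
case: (posP (y - c - r)) => -[? ->]; apply/andP; split; lra.
Qed.

Lemma bump_derive c r y : is_derive y 1 (bump c r) (hat c r y).
Proof. exact: is_derive_quad (bump_quad c r y). Qed.

Lemma bump_ac a b c r : a <= b -> ac a b (bump c r) (hat c r).
Proof.
move=> ab.
have E : derive1 (bump c r) = hat c r.
  by apply/funext => y; rewrite derive1E; apply: derive_val; exact: bump_derive.
rewrite -E; apply: C1_ac => // [x|].
  by have [] := bump_derive c r x.
by rewrite E; apply: lipschitz1_continuous => x y; exact: hat_lip.
Qed.

Lemma itg_hat a b c r : 0 <= r -> a <= c - r -> c + r <= b -> itg a b (hat c r) = r ^+ 2.
Proof.
move=> r0 ac cb; have ab : a <= b by lra.
by rewrite -(ac_sub (bump_ac c r ab)) // (@bump_left c r a) // (@bump_right c r b) // subr0.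
Qed.

(** One bump alone stays at [r ^+ 2] to the right of its centre; in the difference of two these
    plateaus cancel, which gives compact support and a derivative made of two opposite tents. *)
Lemma bumpB_C1c a b c d r : 0 < r -> a < c - r -> c + r < b -> a < d - r -> d + r < b ->
  C1c a b (fun y => bump c r y - bump d r y) /\
  derive1 (fun y => bump c r y - bump d r y) = (fun y => hat c r y - hat d r y).
Proof.
move=> r0 h1 h2 h3 h4.
have D y : is_derive y 1 (fun y => bump c r y - bump d r y) (hat c r y - hat d r y).
  apply: (@is_derive_quad _ _ _ 8) => z.
  have := bump_quad c r y z; have := bump_quad d r y z.
  by rewrite !ler_norml => /andP[? ?] /andP[? ?]; apply/andP; split; lra.
have E : derive1 (fun y => bump c r y - bump d r y) = (fun y => hat c r y - hat d r y).
  by apply/funext => y; rewrite derive1E; exact: derive_val.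
split => //; split.
- by move=> x; have [] := D x.
- rewrite E; apply: (@lipschitz1_continuous _ 8) => x y.
  have := hat_lip c r x y; have := hat_lip d r x y.
  by rewrite !ler_norml => /andP[? ?] /andP[? ?]; apply/andP; split; lra.
- exists (Num.min c d - r), (Num.max c d + r); split.
  + by case: (leP c d).
  + by case: (leP c d).
  move=> x; rewrite in_itv /= negb_and -!ltNge => /orP[] H.
    by rewrite !bump_left ?subrr //; move: H; case: (leP c d) => *; lra.
  by rewrite !bump_right ?subrr //; move: H; case: (leP c d) => *; lra.
Qed.

(** [x] is a Lebesgue point of [k], with the average multiplied out. *)
Definition lebpt k x := forall e, 0 < e -> exists2 d, 0 < d & forall r, 0 < r -> r < d ->
  itg (x - r) (x + r) (fun y => `|k y - k x|) <= e * r.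

Lemma lebpt_ae a b k : intg a b k -> {ae mu, forall x, x \in `]a, b[ -> lebpt k x}.
Proof.
move=> Ik.
have Lk : locally_integrable [set: R] (k \_ `]a, b[).
  by apply: integrable_locally_restrict.
move: (lebesgue_differentiation Lk); apply: filterS.
  exact: (ae_filter_ringOfSetsType mu).
move=> x Hx; rewrite in_itv /= => /andP[ax xb] e e0.
have /fine_cvgP[_ /cvgrPdist_le /(_ (e / 2))] := Hx.
rewrite divr_gt0 // => /(_ isT); rewrite /at_right near_withinE.
move=> /nbhs_ballP[d /= d0 Hd].
(* Below this radius the ball stays inside ]a, b[, where [k] agrees with its extension by zero. *)
exists (Num.min d (Num.min (x - a) (b - x))).
  by rewrite !lt_min d0 !subr_gt0 ax.
move=> r r0; rewrite !lt_min => /and3P[rd ra rb].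
have := Hd r; rewrite /ball /= sub0r normrN gtr0_norm // => /(_ rd r0).
rewrite sub0r normrN /davg /iavg /= lebesgue_measure_ball ?(ltW r0) //.
set I := (X in (_ * X)%E).
have Ia : intg (x - r) (x + r) (fun y => `|k y - k x|).
  apply: intg_norm; apply: intgB; last exact: intg_cst.
  by apply: intgS Ik; lra.
have -> : I = (itg (x - r) (x + r) (fun y => `|k y - k x|))%:E.
  rewrite /itg /Rintegral fineK; last exact: integrable_fin_num.
  rewrite /I -ball_itv; apply: eq_integral => y.
  rewrite inE -ball_normE /= => xyr; rewrite !patchE !ifT ?inE /= ?in_itv /= ?ax ?xb //.
  move: xyr; rewrite ltr_norml => /andP[? ?]; apply/andP; split; lra.
have r2 : r *+ 2 != 0 by rewrite lt0r_neq0 // mulrn_wgt0.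
rewrite inver (negbTE r2) -EFinM /= => H.
have {H} := le_trans (ler_norm _) H.
rewrite mulrC ler_pdivrMr ?mulrn_wgt0 // => /le_trans; apply.
by have -> : e / 2 * (r *+ 2) = e * r by rewrite -mulr_natr; field.
Qed.

Lemma ae_itv_exists a b (P : R -> Prop) : a < b ->
  {ae mu, forall x, x \in `]a, b[ -> P x} -> exists2 x, a < x < b & P x.
Proof.
move=> ab [A [mA A0 sA]]; apply: contrapT => nP.
have : (mu `]a, b[%classic <= mu A)%E.
  apply: le_measure; rewrite ?inE //.
  move=> x /= xab; apply: sA => /= H; apply: nP; exists x; last exact: H.
  by move: xab; rewrite in_itv.
have := @lebesgue_measure_itv R `]a, b[ => /= ->.
by rewrite lte_fin ab A0 -EFinB lee_fin subr_le0 leNgt ab.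
Qed.

Lemma itg_support a b c d f : a <= c -> c <= d -> d <= b -> intg a b f ->
  (forall x, x <= c \/ d <= x -> f x = 0) -> itg a b f = itg c d f.
Proof.
move=> ac cd db If f0.
have z u v : u <= v -> (forall x, u < x < v -> f x = 0) -> itg u v f = 0.
  by move=> uv H; rewrite (@eq_itg _ u v f (fun=> 0)) // itg_cst // mul0r.
rewrite (@itg_split _ a b c) // ?ac ?(le_trans cd) //.
rewrite (@itg_split _ c b d) ?cd //; last exact: intgS If.
rewrite (z a c) // => [|x /andP[_ xc]]; last by apply: f0; left; exact: ltW.
rewrite (z d b) // => [|x /andP[dx _]]; last by apply: f0; right; exact: ltW.
by rewrite add0r addr0.
Qed.

Lemma intg_hat a b k c r : 0 <= r -> intg a b k -> intg a b (fun y => k y * hat c r y).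
Proof.
move=> r0 Ik.
have mh : measurable_fun `]a, b[ (hat c r).
  apply: measurable_funTS; apply: continuous_measurable_fun.
  by apply: lipschitz1_continuous => x y; exact: hat_lip.
have := intg_mulb mh (fun x _ => hat_le c x r0) Ik.
by congr (intg _ _ _); apply/funext => y; rewrite mulrC.
Qed.

(** The tent has mass [r ^+ 2] and height at most [r], so the error is at most [r] times the
    integral of |k - k c|. At a Lebesgue point this is small compared with [r ^+ 2]. *)
Lemma itg_hat_approx a b k c r : 0 < r -> a <= c - r -> c + r <= b -> intg a b k ->
  `|itg a b (fun y => k y * hat c r y) - r ^+ 2 * k c| <=
  r * itg (c - r) (c + r) (fun y => `|k y - k c|).
Proof.
move=> r0 acr crb Ik; have r0' := ltW r0.
have cc : c - r <= c + r by lra.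
have Ik' : intg (c - r) (c + r) k by apply: intgS Ik.
rewrite (itg_support acr cc crb (intg_hat _ r0' Ik)); last first.
  by move=> x H; rewrite hat_out ?mulr0.
have Ih : intg (c - r) (c + r) (hat c r).
  have := intg_hat c r0' (intg_cst (c - r) (c + r) 1).
  by congr (intg _ _ _); apply/funext => y; rewrite mul1r.
have <- := itg_hat r0' (lexx (c - r)) (lexx (c + r)).
rewrite [itg _ _ (hat c r) * _]mulrC -(itgZ (k c) Ih) -itgB //; [|exact: intg_hat|exact: intgZ].
have Ia : intg (c - r) (c + r) (fun y => k y - k c).
  by apply: intgB => //; exact: intg_cst.
have -> : itg (c - r) (c + r) (fun y => k y * hat c r y - k c * hat c r y) =
          itg (c - r) (c + r) (fun y => (k y - k c) * hat c r y).
  by apply: eq_itg => y _; rewrite mulrBl.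
have Ia' := intg_hat c r0' Ia.
rewrite (le_trans (le_norm_itg Ia')) // -itgZ; last exact: intg_norm.
apply: le_itg; [exact: intg_norm|by apply: intgZ; exact: intg_norm|].
by move=> y _; rewrite normrM mulrC ler_wpM2r // hat_le.
Qed.

(** Testing with the difference of bumps at two Lebesgue points [c] and [d] gives r^2 |k d - k c| <=
    e r^2 for small [r]. Hence [k] takes at almost every point its value at one fixed Lebesgue
    point. *)
Lemma du_bois_reymond a b k : a < b -> intg a b k ->
  (forall phi, C1c a b phi -> itg a b (fun x => k x * derive1 phi x) = 0) ->
  exists C : R, {ae mu, forall x, x \in `]a, b[ -> k x = C}.
Proof.
move=> ab Ik Hk.
have Hae := lebpt_ae Ik.
have [c /andP[ac cb] Lc] := ae_itv_exists ab Hae.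
exists (k c); move: Hae; apply: filterS; first exact: (ae_filter_ringOfSetsType mu).
move=> d Ld dab; have {}Ld := Ld dab; move: dab; rewrite in_itv /= => /andP[ad db].
apply/eqP; rewrite -subr_eq0 -normr_le0; apply: ler_addgt0 => e e_gt0; rewrite add0r.
have e2 : 0 < e / 2 by lra.
have [d1 d10 H1] := Lc _ e2; have [d2 d20 H2] := Ld _ e2.
pose m := Num.min (Num.min d1 d2) (Num.min (Num.min (c - a) (b - c)) (Num.min (d - a) (b - d))).
have m0 : 0 < m by rewrite !lt_min d10 d20 !subr_gt0 ac cb ad db.
have [r [r0 rm]] : exists r : R, 0 < r /\ r < m by exists (m / 2); split; lra.
move: rm; rewrite !lt_min => /andP[/andP[r1 r2] /andP[/andP[rc1 rc2] /andP[rd1 rd2]]].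
have hc1 : a < c - r by lra. have hc2 : c + r < b by lra.
have hd1 : a < d - r by lra. have hd2 : d + r < b by lra.
have [Cphi Dphi] := bumpB_C1c r0 hc1 hc2 hd1 hd2.
have := Hk _ Cphi; rewrite Dphi.
have -> : itg a b (fun x => k x * (hat c r x - hat d r x)) =
  itg a b (fun x => k x * hat c r x) - itg a b (fun x => k x * hat d r x).
  rewrite -itgB; [|exact: intg_hat (ltW r0) Ik|exact: intg_hat (ltW r0) Ik].
  by apply: eq_itg => x _; rewrite mulrBr.
have A1 := itg_hat_approx r0 (ltW hc1) (ltW hc2) Ik.
have A2 := itg_hat_approx r0 (ltW hd1) (ltW hd2) Ik.
have B1 := H1 r r0 r1; have B2 := H2 r r0 r2.
have {}A1 := le_trans A1 (ler_wpM2l (ltW r0) B1).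
have {}A2 := le_trans A2 (ler_wpM2l (ltW r0) B2).
move=> E; have r20 : 0 < r ^+ 2 by rewrite exprn_gt0.
rewrite -(ler_pM2l r20) -{1}(gtr0_norm r20) -normrM.
move: A1 A2 E; set X := itg _ _ _; set Y := itg _ _ _.
rewrite !ler_norml => /andP[? ?] /andP[? ?] E; apply/andP; split; lra.
Qed.

End du_bois_reymond.

(** * Square integrable functions and weak primitives *)

Section square_integrable.
Context {R : realType}.
Local Open Scope classical_set_scope.
Local Open Scope complex_scope.
Local Open Scope ring_scope.
Local Notation mu := (@lebesgue_measure R).
Implicit Types (a b c d e r x y z : R) (f g k F G phi : R -> R).

Definition L2r a b f : Prop :=
  measurable_fun `]a, b[ f /\ intg a b (fun x => f x ^+ 2).

Lemma intg_le a b f g : measurable_fun `]a, b[ f -> intg a b g ->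
  (forall x, a < x < b -> `|f x| <= g x) -> intg a b f.
Proof.
move=> mf Ig fg; apply: (le_integrable _ _ _ Ig) => //; first exact/measurable_EFinP.
move=> x /=; rewrite in_itv /= => axb; rewrite lee_fin (le_trans (fg _ axb)) //.
exact: ler_norm.
Qed.

Lemma L2r_mul a b f g : L2r a b f -> L2r a b g -> intg a b (fun x => f x * g x).
Proof.
move=> [mf If] [mg Ig]; apply: (intg_le _ (intgD If Ig)); first exact: measurable_funM.
move=> x _; rewrite normrM -(real_normK (num_real (f x))) -(real_normK (num_real (g x))).
have := sqr_ge0 (`|f x| - `|g x|); have := normr_ge0 (f x); have := normr_ge0 (g x).
by move: `|f x| `|g x| => u v ? ? ?; nra.
Qed.

Lemma L2r_cst a b (k : R) : L2r a b (fun=> k).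
Proof. by split=> //; exact: intg_cst. Qed.

Lemma L2r_intg a b f : L2r a b f -> intg a b f.
Proof.
move=> H; have := L2r_mul H (L2r_cst a b 1).
by congr (intg _ _ _); apply/funext => x; rewrite mulr1.
Qed.

Lemma L2rZ a b (k : R) f : L2r a b f -> L2r a b (fun x => k * f x).
Proof.
move=> [mf If]; split; first exact: measurable_funM.
have := intgZ (k ^+ 2) If.
by congr (intg _ _ _); apply/funext => x; rewrite exprMn.
Qed.

Lemma L2rD a b f g : L2r a b f -> L2r a b g -> L2r a b (fun x => f x + g x).
Proof.
move=> Hf Hg; split; first exact: measurable_funD Hf.1 Hg.1.
have := intgD (intgD Hf.2 Hg.2) (intgZ 2 (L2r_mul Hf Hg)).
by congr (intg _ _ _); apply/funext => x; ring.
Qed.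

Lemma L2rN a b f : L2r a b f -> L2r a b (fun x => - f x).
Proof.
move=> /(L2rZ (-1)); congr (L2r _ _ _); apply/funext => x; by rewrite mulN1r.
Qed.

Lemma L2rB a b f g : L2r a b f -> L2r a b g -> L2r a b (fun x => f x - g x).
Proof. by move=> Hf /L2rN; exact: L2rD. Qed.

Lemma ac_L2r a b F f : ac a b F f -> L2r a b F.
Proof.
move=> H; split; first exact: ac_measurable H.
have := intg_acM H (intg_ac H).
by congr (intg _ _ _); apply/funext => x; rewrite expr2.
Qed.

Lemma L2P a b (f : R -> R[i]) :
  L2 a b f <-> L2r a b (fun x => complex.Re (f x)) /\ L2r a b (fun x => complex.Im (f x)).
Proof.
have E x : Normc.normc (f x) ^+ 2 = complex.Re (f x) ^+ 2 + complex.Im (f x) ^+ 2.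
  by case: (f x) => u v /=; rewrite sqr_sqrtr // addr_ge0 // sqr_ge0.
split=> [[m1 m2 If]|[[m1 I1] [m2 I2]]].
  have I : intg a b (fun x => Normc.normc (f x) ^+ 2).
    apply/integrableP; split.
      apply/measurable_EFinP; rewrite (_ : (fun _ => _) =
        (fun x => complex.Re (f x) ^+ 2 + complex.Im (f x) ^+ 2)); last exact/funext.
      by apply: measurable_funD; apply: measurable_funX.
    move: If; apply: le_lt_trans; rewrite le_eqVlt; apply/orP; left; apply/eqP.
    by apply: eq_integral => x _ /=; rewrite ger0_norm // sqr_ge0.
  split; split=> //; apply: (intg_le _ I) => [|x _]; try exact: measurable_funX.
  - by rewrite E ger0_norm ?sqr_ge0 // lerDl sqr_ge0.
  - by rewrite E ger0_norm ?sqr_ge0 // lerDr sqr_ge0.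
split=> //; have /integrableP[_ +] := intgD I1 I2; apply: le_lt_trans.
rewrite le_eqVlt; apply/orP; left; apply/eqP; apply: eq_integral => x _ /=.
by rewrite E ger0_norm // addr_ge0 // sqr_ge0.
Qed.

Lemma ae_and a b (P Q : R -> Prop) : {ae mu, forall x, x \in `]a, b[ -> P x} ->
  {ae mu, forall x, x \in `]a, b[ -> Q x} ->
  {ae mu, forall x, x \in `]a, b[ -> P x /\ Q x}.
Proof.
move=> HP HQ; move: HP HQ; apply: filterS2; first exact: (ae_filter_ringOfSetsType mu).
by move=> x HP HQ xab; split; [exact: HP|exact: HQ].
Qed.

Lemma ae_mono a b (P Q : R -> Prop) : (forall x, a < x < b -> P x -> Q x) ->
  {ae mu, forall x, x \in `]a, b[ -> P x} -> {ae mu, forall x, x \in `]a, b[ -> Q x}.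
Proof.
move=> PQ; apply: filterS; first exact: (ae_filter_ringOfSetsType mu).
by move=> x HP xab; apply: PQ (HP xab); move: xab; rewrite in_itv.
Qed.

Lemma ae_sub a b c d (P : R -> Prop) : a <= c -> d <= b ->
  {ae mu, forall x, x \in `]a, b[ -> P x} -> {ae mu, forall x, x \in `]c, d[ -> P x}.
Proof.
move=> ac db; apply: filterS; first exact: (ae_filter_ringOfSetsType mu).
move=> x HP; rewrite in_itv /= => /andP[cx xd]; apply: HP.
by rewrite in_itv /= (le_lt_trans ac cx) (lt_le_trans xd db).
Qed.

Lemma ac_ae a b F f g : ac a b F f -> measurable_fun `]a, b[ g ->
  {ae mu, forall x, x \in `]a, b[ -> f x = g x} -> ac a b F g.
Proof.
move=> [If H] mg fg; split.
  apply/integrableP; split; first exact/measurable_EFinP.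
  have /integrableP[mf] := If; apply: le_lt_trans; rewrite le_eqVlt; apply/orP; left; apply/eqP.
  apply: ae_eq_integral => //; try exact: measurableT_comp mf.
    by apply: measurableT_comp => //; exact/measurable_EFinP.
  move: fg; apply: filterS; first exact: (ae_filter_ringOfSetsType mu).
  by move=> x /= h xab; rewrite h // inE.
move=> x /andP[ax xb]; rewrite H ?ax //; congr (_ + _); apply: eq_itg_ae.
- exact: ae_sub (lexx _) xb fg.
- by apply: intg_measurable; apply: intgS If.
- apply: measurable_funS mg => // z /=; rewrite !in_itv /= => /andP[-> zx].
  exact: lt_le_trans zx xb.
Qed.

Lemma C1c_bdry a b phi : C1c a b phi -> phi a = 0 /\ phi b = 0.
Proof.
move=> [_ _ [c [d [ac db H]]]]; split; apply: H; rewrite in_itv /= negb_and -!ltNge ?ac ?db //.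
by rewrite orbT.
Qed.

Lemma intg_mul_cont a b f g : continuous g -> intg a b f -> intg a b (fun x => f x * g x).
Proof.
move=> cg If.
have mg : measurable_fun `]a, b[ g.
  by apply: measurable_funTS; exact: continuous_measurable_fun.
have : compact (g @` `[a, b]).
  by apply: continuous_compact; [exact: continuous_subspaceT|exact: segment_compact].
move=> /compact_bounded[M [_ HM]].
have := @intg_mulb _ a b f g (M + 1) mg _ If.
rewrite (_ : (fun x => g x * f x) = (fun x => f x * g x)); last first.
  by apply/funext => x; rewrite mulrC.
apply=> x /andP[ax xb]; apply: HM; first by rewrite ltrDl.
by exists x => //=; rewrite in_itv /= !ltW.
Qed.

(** By the product rule the primitive of [g] satisfies the same weak identity as [f], so their
    difference is orthogonal to all derivatives of test functions and is constant by
    [du_bois_reymond]. *)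
Lemma weak_primitive a b f g : a < b -> intg a b f -> intg a b g ->
  (forall phi, C1c a b phi ->
    itg a b (fun x => f x * derive1 phi x) = - itg a b (fun x => g x * phi x)) ->
  exists2 F, ac a b F g & {ae mu, forall x, x \in `]a, b[ -> f x = F x}.
Proof.
move=> ab If Ig H; have HG := ac_primitive Ig.
have [||C HC] := @du_bois_reymond _ a b (fun x => f x - itg a x g) ab.
- by apply: intgB => //; exact: intg_ac HG.
- move=> phi Cphi; have [pa pb] := C1c_bdry Cphi; have [d1 c1 _] := Cphi.
  have Hphi := C1_ac (ltW ab) d1 c1.
  have HM := acM HG Hphi.
  have /= := ac_sub HM (lexx a) (ltW ab) (lexx b).
  have I1 := intg_acM HG Hphi.1; have I2 := intg_acM Hphi Ig.
  rewrite itgD // pa pb !mulr0 subr0.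
  have If' := intg_mul_cont c1 If.
  rewrite (@eq_itg _ a b (fun x => (f x - itg a x g) * derive1 phi x)
    (fun x => f x * derive1 phi x - itg a x g * derive1 phi x)); last first.
    by move=> x _; rewrite mulrBl.
  rewrite itgB // H // => E.
  rewrite (@eq_itg _ a b (fun x => g x * phi x) (fun x => phi x * g x)); last first.
    by move=> x _; rewrite mulrC.
  lra.
exists (fun x => C + itg a x g).
  have := acD (ac_cst a b C) HG; apply: eq_ac => //; last exact: ltW.
  by move=> x _; rewrite add0r.
by apply: ae_mono HC => x _ <-; rewrite subrK.
Qed.

End square_integrable.

(** * Weak derivatives and continuous representatives *)

Section weak_derivatives.
Context {R : realType}.
Local Open Scope classical_set_scope.
Local Open Scope complex_scope.
Local Open Scope ring_scope.
Local Notation mu := (@lebesgue_measure R).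
Local Notation Re := (@complex.Re R).
Local Notation Im := (@complex.Im R).
Implicit Types (a b c d e r x y z : R) (f g s P Q : R -> R[i]).

(** A null set contains no interval, so points of agreement exist arbitrarily close to [x], on one
    side only when [x] is an endpoint. *)
Lemma continuous_ae_eq a b (F G : R -> R) : a < b ->
  {within `[a, b], continuous F} -> {within `[a, b], continuous G} ->
  {ae mu, forall x, x \in `]a, b[ -> F x = G x} -> forall x, a <= x <= b -> F x = G x.
Proof.
move=> ab cF cG FG x /andP[ax xb].
apply/eqP; rewrite -subr_eq0 -normr_le0; apply: ler_addgt0 => e e_gt0.
rewrite add0r; have e2 : 0 < e / 2 by lra.
have loc (H : R -> R) : {within `[a, b], continuous H} ->
    exists2 d, 0 < d & forall y, a <= y <= b -> `|x - y| < d -> `|H x - H y| < e / 2.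
  move=> /subspace_continuousP/(_ x); rewrite /= in_itv /= ax xb => /(_ isT).
  move=> /cvgrPdist_lt/(_ _ e2); rewrite near_withinE => /nbhs_ballP[d /= d0 Hd].
  exists d => // y yab xy; apply: Hd; first by rewrite -ball_normE.
  by rewrite /= in_itv.
have [d1 d10 H1] := loc F cF; have [d2 d20 H2] := loc G cG.
pose d := Num.min d1 d2.
have d0 : 0 < d by rewrite lt_min d10.
have h1 : a <= Num.max a (x - d) by rewrite le_max lexx.
have h2 : Num.min b (x + d) <= b by rewrite ge_min lexx.
have h3 : Num.max a (x - d) < Num.min b (x + d).
  by rewrite lt_min !gt_max ab /=; apply/andP; split; [|apply/andP; split]; lra.
have [y /andP[]] := ae_itv_exists h3 (ae_sub h1 h2 FG).
rewrite gt_max lt_min => /andP[ay xdy] /andP[yb yxd] FGy.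
have yab : a <= y <= b by rewrite !ltW.
have : `|x - y| < d by rewrite ltr_norml; apply/andP; split; lra.
rewrite lt_min => /andP[/(H1 _ yab) K1 /(H2 _ yab) K2].
have -> : F x - G x = (F x - F y) - (G x - G y) by rewrite FGy; ring.
by rewrite (le_trans (ler_normB _ _)) //; lra.
Qed.

Lemma ae_ReIm a b f g : ae_eq_on a b f g ->
  {ae mu, forall x, x \in `]a, b[ -> Re (f x) = Re (g x)} /\
  {ae mu, forall x, x \in `]a, b[ -> Im (f x) = Im (g x)}.
Proof. by move=> H; split; apply: ae_mono H => x _ ->. Qed.

Definition cac a b P Q : Prop :=
  ac a b (fun x => Re (P x)) (fun x => Re (Q x)) /\
  ac a b (fun x => Im (P x)) (fun x => Im (Q x)).

(** [crep] is an arbitrary choice, but continuity makes it unique on [a, b]; boundary values can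
    thus be computed from any absolutely continuous representative. *)
Lemma crepP a b f P Q : a < b -> cac a b P Q -> ae_eq_on a b f P ->
  forall x, a <= x <= b -> crep a b f x = P x.
Proof.
move=> ab [/ac_continuous c1 /ac_continuous c2] fP x xab.
have := @xgetPex _ (fun=> 0 : R[i]) [set g |
    [/\ {within `[a, b], continuous (fun x => complex.Re (g x))},
        {within `[a, b], continuous (fun x => complex.Im (g x))} &
        ae_eq_on a b f g]] (ex_intro _ P (And3 c1 c2 fP)).
rewrite -/(crep a b f) => -[c1' c2' fC].
have CP : ae_eq_on a b (crep a b f) P.
  by apply: ae_mono (ae_and fP fC) => z _ [<- ->].
have [CP1 CP2] := ae_ReIm CP.
have E1 := continuous_ae_eq ab c1' c1 CP1 xab.
have E2 := continuous_ae_eq ab c2' c2 CP2 xab.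
by move: E1 E2; case: (crep a b f x) => u v; case: (P x) => u' v' /= -> ->.
Qed.

(** Real test functions split the complex weak identity into real and imaginary parts, and
    [weak_primitive] applies to each. *)
Lemma H1_primitive a b f : a < b -> H1 a b f ->
  L2 a b (wderiv a b f) /\
  exists2 P, cac a b P (wderiv a b f) & ae_eq_on a b f P.
Proof.
move=> ab [Lf /(@xgetPex _ (fun=> 0 : R[i]))].
rewrite -/(wderiv a b f); move: (wderiv a b f) => g [Lg H]; split => //.
have /L2P[Lf1 Lf2] := Lf; have /L2P[Lg1 Lg2] := Lg.
have [|F1 A1 B1] := weak_primitive ab (L2r_intg Lf1) (L2r_intg Lg1).
  move=> phi Cphi; have := H phi Cphi; rewrite /cint => -[].
  rewrite -/(itg _ _ _) -/(itg _ _ _) => E1 _.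
  rewrite (@eq_itg _ _ _ _ (fun x => Re (f x * (phi^`()%classic x)%:C))); last first.
    by move=> x _; case: (f x) => u v /=; ring.
  rewrite E1; congr (- _); apply: eq_itg.
  by move=> x _; case: (g x) => u v /=; ring.
have [|F2 A2 B2] := weak_primitive ab (L2r_intg Lf2) (L2r_intg Lg2).
  move=> phi Cphi; have := H phi Cphi; rewrite /cint => -[] _.
  rewrite -/(itg _ _ _) -/(itg _ _ _) => E1.
  rewrite (@eq_itg _ _ _ _ (fun x => Im (f x * (phi^`()%classic x)%:C))); last first.
    by move=> x _; case: (f x) => u v /=; ring.
  rewrite E1; congr (- _); apply: eq_itg.
  by move=> x _; case: (g x) => u v /=; ring.
exists (fun x => F1 x +i* F2 x); first by split.
apply: ae_mono (ae_and B1 B2) => x _.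
by case: (f x) => u v /= [-> ->].
Qed.

Lemma cac_crep a b f Q : a < b -> H1 a b f -> ae_eq_on a b (wderiv a b f) Q ->
  L2 a b Q -> cac a b (crep a b f) Q /\ ae_eq_on a b f (crep a b f).
Proof.
move=> ab Hf fQ [m1 m2 _]; have [_ [P cP fP]] := H1_primitive ab Hf.
have E := crepP ab cP fP.
split; last first.
  apply: ae_mono fP => x /andP[ax xb] ->; rewrite E // !ltW //.
have ab' := ltW ab.
have [fQ1 fQ2] := ae_ReIm fQ.
by split; [have := ac_ae cP.1 m1 fQ1|have := ac_ae cP.2 m2 fQ2];
  apply: eq_ac => // x /E ->.
Qed.

(** The derivative of [crep a b f] is taken to be the continuous representative of the weak
    derivative, so that the functions whose boundary values occur in [domA] are those entering the
    integrations by parts. *)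
Lemma H2_crep a b f (g := wderiv a b f) (s := wderiv a b g) : a < b -> H2 a b f ->
  [/\ cac a b (crep a b f) (crep a b g), cac a b (crep a b g) s,
      ae_eq_on a b f (crep a b f) & L2 a b s].
Proof.
move=> ab [Hf Hg]; have [Ls _] := H1_primitive ab Hg.
have Es : ae_eq_on a b s s by apply: aeW => x _.
have [cg eg] := cac_crep ab Hg Es Ls.
have Lg : L2 a b (crep a b g).
  by apply/L2P; split; [exact: ac_L2r cg.1|exact: ac_L2r cg.2].
have [cf ef] := cac_crep ab Hf eg Lg.
by split.
Qed.

End weak_derivatives.

(** * Energy estimates and flux identities on one edge *)

Section interval_estimates.
Context {R : realType}.
Local Open Scope classical_set_scope.
Local Open Scope complex_scope.
Local Open Scope ring_scope.
Local Notation Re := (@complex.Re R).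
Local Notation Im := (@complex.Im R).
Implicit Types (a b c x y z : R) (f g s p q : R -> R[i]) (e r h : R -> R).

Definition sqnorm a b f : R := itg a b (fun x => Re (f x) ^+ 2 + Im (f x) ^+ 2).

Lemma intg_sqnorm a b f : L2 a b f -> intg a b (fun x => Re (f x) ^+ 2 + Im (f x) ^+ 2).
Proof. by move=> /L2P[[_ I1] [_ I2]]; exact: intgD. Qed.

Lemma sqnorm_ge0 a b f : 0 <= sqnorm a b f.
Proof. by apply: itg_ge0 => x _; rewrite addr_ge0 ?sqr_ge0. Qed.

Lemma cac_L2 a b p q : cac a b p q -> L2 a b p.
Proof. by move=> [c1 c2]; apply/L2P; split; [exact: ac_L2r c1|exact: ac_L2r c2]. Qed.

(* On an interval of length 1 the term [e / 2] is absorbed: integrating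
   [e x <= e a + (itg e) / 2 + itg h] bounds [itg e] itself. *)
Lemma absorb_step a b e r h : b - a = 1 -> ac a b e r -> intg a b h ->
  (forall x, a < x < b -> `|r x| <= e x / 2 + h x) ->
  (forall x, a <= x <= b -> 0 <= e x) -> (forall x, a < x < b -> 0 <= h x) ->
  [/\ itg a b e <= 2 * (e a + itg a b h), e b <= 2 * (e a + itg a b h),
      itg a b e <= 2 * (e b + itg a b h) & e a <= 2 * (e b + itg a b h)].
Proof.
move=> ba1 ce Ih re e0 h0; have ab : a <= b by lra.
have Ie := intg_ac ce; have Ir := ce.1.
have H0 : 0 <= itg a b h by exact: itg_ge0.
have E0 : 0 <= itg a b e by apply: itg_ge0 => x /andP[ax xb]; apply: e0; rewrite !ltW.
have Ieh x y : a <= x -> y <= b -> intg x y (fun z => 2^-1 * e z + h z).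
  by move=> ax yb; apply: intgD; [apply: intgZ|]; [apply: intgS Ie|apply: intgS Ih].
have key x y : a <= x -> x <= y -> y <= b -> `|e y - e x| <= itg a b e / 2 + itg a b h.
  move=> ax xy yb; rewrite (ac_sub ce) //.
  have Irxy : intg x y r by apply: intgS Ir.
  apply: (@le_trans _ _ (itg x y (fun z => 2^-1 * e z + h z))).
    rewrite (le_trans (le_norm_itg Irxy)) //; apply: le_itg.
    - exact: intg_norm.
    - exact: Ieh.
    move=> z /andP[xz zy]; rewrite mulrC; apply: re.
    by rewrite (le_lt_trans ax xz) (lt_le_trans zy yb).
  have -> : itg a b e / 2 + itg a b h = itg a b (fun z => 2^-1 * e z + h z).
    by rewrite itgD ?itgZ // 1?mulrC //; exact: intgZ.
  have nn z : a < z < b -> 0 <= 2^-1 * e z + h z.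
    move=> zab; rewrite addr_ge0 ?h0 // mulr_ge0 //.
    by apply: e0; case/andP: zab => ? ?; rewrite !ltW.
  rewrite [leRHS](@itg_split _ a b x) ?ax ?(le_trans xy) //; last exact: Ieh.
  rewrite (@itg_split _ x b y) ?xy //; last exact: Ieh.
  rewrite addrCA lerDl addr_ge0 //; apply: itg_ge0 => z /andP[h1 h2]; apply: nn.
  - by rewrite h1 (lt_le_trans h2) // (le_trans xy).
  - by rewrite h2 andbT (le_lt_trans _ h1) // (le_trans ax).
have up (c : R) : (forall x, a <= x <= b -> e x <= c) -> itg a b e <= c.
  move=> ec; have := @le_itg _ a b e (fun=> c) Ie (intg_cst _ _ _).
  rewrite itg_cst // ba1 mulr1; apply=> x /andP[ax xb]; apply: ec; rewrite !ltW //.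
have A x : a <= x <= b -> e x <= e a + (itg a b e / 2 + itg a b h).
  by move=> /andP[ax xb]; have := key _ _ (lexx a) ax xb; rewrite ler_norml => /andP[_]; lra.
have B x : a <= x <= b -> e x <= e b + (itg a b e / 2 + itg a b h).
  by move=> /andP[ax xb]; have := key _ _ ax xb (lexx b); rewrite ler_norml => /andP[+ _]; lra.
have A' := up _ A; have B' := up _ B.
have Ab := A b; have Ba := B a; rewrite ab !lexx in Ab Ba.
by have {}Ab := Ab isT; have {}Ba := Ba isT; split; lra.
Qed.

(** The weight leaves one half of [k * u ^+ 2], exactly the share that [absorb_step] can absorb. *)
Lemma mul_le_AMGM (k u v : R) : 0 < k -> `|2 * u * v| <= k * u ^+ 2 / 2 + 2 / k * v ^+ 2.
Proof.
move=> k0.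
have P : 0 <= (k * u - 2 * v) ^+ 2 / (2 * k) by rewrite divr_ge0 ?sqr_ge0 // mulr_ge0 // ltW.
have Q : 0 <= (k * u + 2 * v) ^+ 2 / (2 * k) by rewrite divr_ge0 ?sqr_ge0 // mulr_ge0 // ltW.
have E1 : (k * u - 2 * v) ^+ 2 / (2 * k) = k * u ^+ 2 / 2 + 2 / k * v ^+ 2 - 2 * u * v.
  by field; rewrite gt_eqF.
have E2 : (k * u + 2 * v) ^+ 2 / (2 * k) = k * u ^+ 2 / 2 + 2 / k * v ^+ 2 + 2 * u * v.
  by field; rewrite gt_eqF.
rewrite E1 in P; rewrite E2 in Q.
by rewrite ler_norml; apply/andP; split; lra.
Qed.

(* [i beta p - F] for [F = - i k s] *)
Definition resid (k beta : R) p s : R -> R[i] := fun x =>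
  (- (beta * Im (p x)) - k * Im (s x)) +i* (beta * Re (p x) + k * Re (s x)).

Lemma resid_L2 a b (k beta : R) p s : L2 a b p -> L2 a b s -> L2 a b (resid k beta p s).
Proof.
move=> /L2P[p1 p2] /L2P[s1 s2]; apply/L2P; split => /=.
  by apply: L2rB; [apply: L2rN|]; apply: L2rZ.
by apply: L2rD; apply: L2rZ.
Qed.

(** Here [x] plays the role of time. Since k s + beta p = - i f for the residual f, the derivative 2
    Re((k s + beta p) conj q) of the energy involves only [q] and f, whatever the size of [beta]. *)
Lemma sidewise_step a b (k beta : R) p q s : b - a = 1 -> 0 < k -> 0 <= beta ->
  cac a b p q -> cac a b q s -> L2 a b s ->
  let e x := k * (Re (q x) ^+ 2 + Im (q x) ^+ 2) + beta * (Re (p x) ^+ 2 + Im (p x) ^+ 2) in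
  itg a b e <= 2 * (e a + 2 / k * sqnorm a b (resid k beta p s)) /\
  e b <= 2 * (e a + 2 / k * sqnorm a b (resid k beta p s)).
Proof.
move=> ba1 k0 b0 [cp1 cp2] [cq1 cq2] Ls e.
have Lf := resid_L2 k beta (cac_L2 (conj cp1 cp2)) Ls.
set f := resid k beta p s in Lf *.
have ab : a <= b by lra.
have ce : ac a b e (fun x => 2 * Re (q x) * Im (f x) - 2 * Im (q x) * Re (f x)).
  have := acD (acZ k (acD (acM cq1 cq1) (acM cq2 cq2)))
     (acZ beta (acD (acM cp1 cp1) (acM cp2 cp2))).
  apply: eq_ac => // x _.
  by rewrite /f /resid /=; ring.
have Ih := intgZ (2 / k) (intg_sqnorm Lf).
have H := absorb_step ba1 ce Ih.
have Esq : itg a b (fun x => 2 / k * (Re (f x) ^+ 2 + Im (f x) ^+ 2)) = 2 / k * sqnorm a b f.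
  by rewrite itgZ //; exact: intg_sqnorm.
have e0 x : 0 <= e x.
  by rewrite addr_ge0 // mulr_ge0 ?addr_ge0 ?sqr_ge0 // ltW.
rewrite Esq in H; have [|x _| x _|] := H; [|exact: e0| |by move=> ? ?; split].
  move=> x _; have A1 := mul_le_AMGM (Re (q x)) (Im (f x)) k0.
  have A2 := mul_le_AMGM (Im (q x)) (Re (f x)) k0.
  rewrite (le_trans (ler_normB _ _)) //.
  have : 0 <= beta * (Re (p x) ^+ 2 + Im (p x) ^+ 2) by rewrite mulr_ge0 ?addr_ge0 ?sqr_ge0.
  by rewrite /e; lra.
by rewrite mulr_ge0 ?divr_ge0 ?addr_ge0 ?sqr_ge0 // ltW.
Qed.

(** The estimate runs from [b] back to [a], because the Dirichlet end of the network is on the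
    right. *)
Lemma poincare_step a b p q : b - a = 1 -> cac a b p q -> L2 a b q ->
  let e x := Re (p x) ^+ 2 + Im (p x) ^+ 2 in
  itg a b e <= 2 * (e b + 2 * sqnorm a b q) /\ e a <= 2 * (e b + 2 * sqnorm a b q).
Proof.
move=> ba1 [cp1 cp2] Lq e; have ab : a <= b by lra.
have ce : ac a b e (fun x => 2 * Re (p x) * Re (q x) + 2 * Im (p x) * Im (q x)).
  have := acD (acM cp1 cp1) (acM cp2 cp2).
  by apply: eq_ac => // x _; rewrite /e; ring.
have Ih := intgZ 2 (intg_sqnorm Lq).
have H := absorb_step ba1 ce Ih.
have Esq : itg a b (fun x => 2 * (Re (q x) ^+ 2 + Im (q x) ^+ 2)) = 2 * sqnorm a b q.
  by rewrite itgZ //; exact: intg_sqnorm.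
rewrite Esq in H; have [|x _| x _|] := H; [| | |by move=> ? ?; split].
- move=> x _; have A1 := mul_le_AMGM (Re (p x)) (Re (q x)) ltr01.
  have A2 := mul_le_AMGM (Im (p x)) (Im (q x)) ltr01.
  by rewrite (le_trans (ler_normD _ _)) // /e; lra.
- by rewrite addr_ge0 ?sqr_ge0.
- by rewrite mulr_ge0 // addr_ge0 ?sqr_ge0.
Qed.

(** Real and imaginary parts of one integration by parts of f conj p. The boundary terms W and Z are
    the imaginary and real parts of k q conj p, a quantity that the joint conditions make
    continuous. *)
Lemma flux_identity a b (k beta : R) p q s : a <= b ->
  cac a b p q -> cac a b q s -> L2 a b s ->
  let f := resid k beta p s in
  let W x := k * (Im (q x) * Re (p x) - Re (q x) * Im (p x)) in
  let Z x := k * (Re (q x) * Re (p x) + Im (q x) * Im (p x)) in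
  itg a b (fun x => Re (f x) * Re (p x) + Im (f x) * Im (p x)) = - (W b - W a) /\
  beta * sqnorm a b p - itg a b (fun x => Im (f x) * Re (p x) - Re (f x) * Im (p x)) =
    k * sqnorm a b q - (Z b - Z a).
Proof.
move=> ab [cp1 cp2] [cq1 cq2] Ls f W Z.
have Lp := cac_L2 (conj cp1 cp2); have Lq := cac_L2 (conj cq1 cq2).
have Lf := resid_L2 k beta Lp Ls; rewrite -/f in Lf.
have cW : ac a b W (fun x => - (Re (f x) * Re (p x) + Im (f x) * Im (p x))).
  have := acZ k (acD (acM cq2 cp1) (acZ (-1) (acM cq1 cp2))).
  by apply: eq_ac => // x _; rewrite /W /f /resid /=; ring.
have cZ : ac a b Z (fun x => k * (Re (q x) ^+ 2 + Im (q x) ^+ 2) -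
    (beta * (Re (p x) ^+ 2 + Im (p x) ^+ 2) - (Im (f x) * Re (p x) - Re (f x) * Im (p x)))).
  have := acZ k (acD (acM cq1 cp1) (acM cq2 cp2)).
  by apply: eq_ac => // x _; rewrite /Z /f /resid /=; ring.
have /L2P[Lp1 Lp2] := Lp; have /L2P[Lf1 Lf2] := Lf.
rewrite (ac_sub cW) // (ac_sub cZ) //; split.
  by rewrite itgN ?opprK //; apply: intgD; exact: L2r_mul.
have I1 := intg_sqnorm Lp; have I2 := intg_sqnorm Lq.
have I3 : intg a b (fun x => Im (f x) * Re (p x) - Re (f x) * Im (p x)).
  by apply: intgB; exact: L2r_mul.
rewrite [X in _ = _ - X]itgB; [|exact: intgZ|by apply: intgB => //; exact: intgZ].
rewrite [X in _ = _ - (_ - X)]itgB //; last exact: intgZ.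
by rewrite !itgZ // /sqnorm; ring.
Qed.

End interval_estimates.

(** * Estimates along the network and the resolvent bound *)

Section network_estimates.
Context {R : realType} (N : nat).
Local Open Scope classical_set_scope.
Local Open Scope complex_scope.
Local Open Scope ring_scope.
Local Notation Re := (@complex.Re R).
Local Notation Im := (@complex.Im R).
Local Notation field := ('I_N -> R -> R[i]).
Implicit Types (j k : 'I_N) (p q s : field).

(* [p], [q], [s] represent a field of the domain and its first two derivatives, the
   first two by their continuous representatives; unlike [wderiv], which chooses an
   arbitrary representative, such triples are stable under linear combinations. *)
Record elastic (rho : 'I_N -> R) p q s : Prop := Elastic {
  elastic_dp : forall j, cac j%:R j.+1%:R (p j) (q j);
  elastic_dq : forall j, cac j%:R j.+1%:R (q j) (s j);
  elastic_L2 : forall j, L2 j%:R j.+1%:R (s j);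
  elastic_left : forall j, j = 0%N :> nat -> (rho j)%:C * q j 0 = ('i)%C * p j 0;
  elastic_right : forall j, j.+1 = N -> p j N%:R = 0;
  elastic_p_joint : forall j k, k = j.+1 :> nat -> p j k%:R = p k k%:R;
  elastic_q_joint : forall j k, k = j.+1 :> nat ->
    (rho j)%:C * q j k%:R = (rho k)%:C * q k k%:R }.

Definition sqnormN p : R := \sum_(j < N) sqnorm j%:R j.+1%:R (p j).

Lemma sqnormN_ge0 p : 0 <= sqnormN p.
Proof. by apply: sumr_ge0 => j _; exact: sqnorm_ge0. Qed.

Lemma network_telescope (W : 'I_N -> R -> R) j0 : j0 = 0%N :> nat ->
  (forall j k, k = j.+1 :> nat -> W j k%:R = W k k%:R) ->
  (forall j, j.+1 = N -> W j N%:R = 0) ->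
  \sum_(j < N) (W j j.+1%:R - W j j%:R) = - W j0 0.
Proof.
move=> j00 Wj WN.
(* The default 0 is reached at [n = N], where it agrees with the vanishing of W at the right end. *)
pose w (n : nat) : R := if insub n is Some j then W j n%:R else 0.
have w1 j : w j = W j j%:R by rewrite /w valK.
have w2 j : w j.+1 = W j j.+1%:R.
  rewrite /w; case: insubP => [k _ kj|]; first by rewrite -kj (Wj j k).
  by rewrite -leqNgt => Nj; have jN : j.+1 = N by [apply/eqP; rewrite eqn_leq Nj ltn_ord];
     rewrite jN WN.
rewrite (eq_bigr (fun j : 'I_N => w j.+1 - w j)); last by move=> j _; rewrite w1 w2.
rewrite -(big_mkord xpredT (fun n => w n.+1 - w n)) telescope_sumr //.
have -> : w 0%N = W j0 0 by rewrite -j00 w1 j00.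
by rewrite /w insubF ?sub0r // ltnn.
Qed.

(** Adding [c] makes the recursion homogeneous: one edge and one joint give x_k + c <= 2 kappa (x_j
    + c) + c <= 3 kappa (x_j + c). *)
Lemma chain_growth (x y : 'I_N -> R) (kappa c : R) : 1 <= kappa -> 0 <= c ->
  (forall j, 0 <= x j) -> (forall j, y j <= 2 * (x j + c)) ->
  (forall j k, k = j.+1 :> nat -> x k <= kappa * y j) ->
  forall j0 j, j0 = 0%N :> nat -> x j + c <= (3 * kappa) ^+ N * (x j0 + c).
Proof.
move=> k1 c0 x0 yx xy j0 j j00.
have kp : 1 <= 3 * kappa by lra.
suff H n : forall j, j = n :> nat -> x j + c <= (3 * kappa) ^+ n * (x j0 + c).
  apply: (le_trans (H _ j erefl)); rewrite ler_wpM2r ?addr_ge0 //.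
  by rewrite ler_weXn2l // ltnW.
elim: n => [|n IH] k kn.
  have -> : k = j0 by apply: val_inj; rewrite /= kn j00.
  by rewrite expr0 mul1r.
have nN : (n < N)%N by rewrite -[n.+1]kn ltnW.
have kj : k = (Ordinal nN).+1 :> nat by [].
have := xy _ _ kj; have := yx (Ordinal nN); have := IH (Ordinal nN) erefl.
have := x0 (Ordinal nN).
set u := x (Ordinal nN); set v := y _; rewrite exprS.
set E := _ ^+ n * _ => u0 uE vu xv.
have h1 : kappa * v <= kappa * (2 * (u + c)) by rewrite ler_wpM2l //; lra.
have h2 : 0 <= (kappa - 1) * (u + c) by rewrite mulr_ge0 //; lra.
have h3 : kappa * (u + c) <= kappa * E by rewrite ler_wpM2l //; lra.
rewrite -mulrA -/E; lra.
Qed.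

Variable rho : 'I_N -> R.
Hypothesis rho_gt0 : forall j, 0 < rho j.

(** A common upper bound for all [(rho j)^-1]; a sum is simpler to handle than a maximum. *)
Definition compliance : R := \sum_(j < N) (rho j)^-1.

Lemma compliance_ge j : (rho j)^-1 <= compliance.
Proof.
rewrite /compliance (bigD1 j) //= lerDl; apply: sumr_ge0 => k _.
by rewrite invr_ge0 ltW.
Qed.

Lemma compliance_ge0 : 0 <= compliance.
Proof. by apply: sumr_ge0 => k _; rewrite invr_ge0 ltW. Qed.

Lemma sqnorm_le_N p j : sqnorm j%:R j.+1%:R (p j) <= sqnormN p.
Proof.
rewrite /sqnormN (bigD1 j) //= lerDl; apply: sumr_ge0 => k _; exact: sqnorm_ge0.
Qed.

Lemma unit_interval j : j.+1%:R - j%:R = 1 :> R.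
Proof. by rewrite -natr1; ring. Qed.

Lemma poincare : exists2 K : R, 1 <= K & forall p q s, elastic rho p q s ->
  sqnormN p <= K * \sum_(j < N) rho j * sqnorm j%:R j.+1%:R (q j).
Proof.
(* Each of the N edges contributes at most 2 * 3^N * 2 |q|^2, and |q|^2 is at most [compliance]
   times the elastic energy. The summand 1 gives K >= 1, so that [K] can be inverted later. *)
exists (1 + 4 * N%:R * 3 ^+ N * compliance).
  rewrite lerDl !mulr_ge0 ?exprn_ge0 //; exact: compliance_ge0.
move=> p q s H; set D := \sum_(j < N) _.
have D0 : 0 <= D by apply: sumr_ge0 => j _; rewrite mulr_ge0 ?sqnorm_ge0 // ltW.
have QD : sqnormN q <= compliance * D.
  rewrite /sqnormN mulr_sumr; apply: ler_sum => j _.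
  rewrite mulrA ler_peMl ?sqnorm_ge0 //.
  by rewrite -(mulVf (lt0r_neq0 (rho_gt0 j))) ler_wpM2r ?compliance_ge // ltW.
pose c := 2 * sqnormN q.
have c0 : 0 <= c by rewrite mulr_ge0 ?sqnormN_ge0.
pose e j (x : R) := Re (p j x) ^+ 2 + Im (p j x) ^+ 2.
have e0 j x : 0 <= e j x by rewrite addr_ge0 ?sqr_ge0.
have step j : sqnorm j%:R j.+1%:R (p j) <= 2 * (e j j.+1%:R + c) /\
              e j j%:R <= 2 * (e j j.+1%:R + c).
  have [h1 h2] := poincare_step (unit_interval j) (elastic_dp H j) (cac_L2 (elastic_dq H j)).
  have := sqnorm_le_N q j => h3.
  by rewrite -/(e j _) in h1 h2; split; [apply: le_trans h1 _|apply: le_trans h2 _];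
    rewrite /c; lra.
have [N0|N0] := posnP N.
  have -> : sqnormN p = 0 by rewrite /sqnormN big1 // => -[n hn]; exfalso; rewrite N0 in hn.
  by rewrite mulr_ge0 // addr_ge0 // !mulr_ge0 ?exprn_ge0 // compliance_ge0.
pose j0 := Ordinal N0.
(* Edges are numbered from the end x = N, where the chain starts from the value 0. The joint factor
   is 1 because [p] itself is continuous. *)
pose x j := e (rev_ord j) (rev_ord j).+1%:R.
pose y j := e (rev_ord j) (rev_ord j)%:R.
have xj0 : x j0 = 0.
  have E : (rev_ord j0).+1 = N by rewrite /= subn1 prednK.
  by rewrite /x /e E (elastic_right H E) /= expr0n addr0.
have chain j : x j + c <= (3 * 1) ^+ N * (x j0 + c).
  apply: (@chain_growth x y) => //.
  - by move=> k; exact: e0.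
  - by move=> k; exact: (step (rev_ord k)).2.
  - move=> i k ki; rewrite mul1r /x /y.
    have E : rev_ord i = (rev_ord k).+1 :> nat by rewrite /= ki subnSK // -ki.
    by rewrite -E /e (elastic_p_joint H E).
rewrite xj0 add0r mulr1 in chain.
have B j : sqnorm j%:R j.+1%:R (p j) <= 2 * (3 ^+ N * c).
  apply: le_trans (step j).1 _; rewrite ler_wpM2l //.
  by have := chain (rev_ord j); rewrite /x rev_ordK.
apply: (@le_trans _ _ (N%:R * (2 * (3 ^+ N * c)))).
  have -> : N%:R * (2 * (3 ^+ N * c)) = \sum_(j < N) (2 * (3 ^+ N * c)).
    by rewrite sumr_const card_ord mulr_natl.
  by apply: ler_sum => j _; exact: B.
have F0 : 0 <= 4 * N%:R * 3 ^+ N :> R by rewrite !mulr_ge0 ?exprn_ge0.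
have := ler_wpM2l F0 QD; rewrite /c => h.
apply: (@le_trans _ _ (4 * N%:R * 3 ^+ N * sqnormN q)).
  by rewrite le_eqVlt; apply/orP; left; apply/eqP; ring.
by apply: le_trans h _; rewrite mulrDl mul1r mulrA; lra.
Qed.

Definition residN (beta : R) p s : field := fun j => resid (rho j) beta (p j) (s j).

Definition trace2 j p : R := Re (p j 0) ^+ 2 + Im (p j 0) ^+ 2.

(** At a joint, rho_i q_i = rho_k q_k multiplies rho |q|^2 by rho_i / rho_k, which is at most
    [kappa], while |p|^2 is continuous. At x = 0, rho q = i p turns rho |q|^2 into |p|^2 / rho, so
    the trace of [p] alone starts the chain. *)
Lemma sidewise : exists2 G : R, 0 <= G & forall (beta : R) p q s j0, 0 <= beta ->
  elastic rho p q s -> j0 = 0%N :> nat ->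
  beta * sqnormN p <=
  G * ((compliance + beta) * trace2 j0 p + 2 * compliance * sqnormN (residN beta p s)).
Proof.
pose kappa : R := 1 + \sum_(j < N) \sum_(k < N) rho j / rho k.
have r0 j k : 0 <= rho j / rho k by rewrite divr_ge0 // ltW.
have kappa_ge j k : rho j / rho k <= kappa.
  apply: (@le_trans _ _ (\sum_(i < N) \sum_(l < N) rho i / rho l)); last by rewrite /kappa lerDr.
  rewrite (bigD1 j) //= (bigD1 k) //= -addrA lerDl addr_ge0 ?sumr_ge0 // => i _.
  by rewrite sumr_ge0.
have k1 : 1 <= kappa by rewrite lerDl sumr_ge0 // => i _; rewrite sumr_ge0.
exists (N%:R * 2 * (3 * kappa) ^+ N); first by rewrite !mulr_ge0 ?exprn_ge0 //; lra.
move=> beta p q s j0 b0 H j00.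
set f := residN beta p s; set B := sqnormN f.
pose c := 2 * compliance * B.
have c0 : 0 <= c by rewrite !mulr_ge0 ?sqnormN_ge0 // compliance_ge0.
pose e j (x : R) := rho j * (Re (q j x) ^+ 2 + Im (q j x) ^+ 2)
                    + beta * (Re (p j x) ^+ 2 + Im (p j x) ^+ 2).
have e0 j x : 0 <= e j x.
  by rewrite addr_ge0 // mulr_ge0 ?addr_ge0 ?sqr_ge0 // ltW.
have step j : itg j%:R j.+1%:R (e j) <= 2 * (e j j%:R + c) /\
              e j j.+1%:R <= 2 * (e j j%:R + c).
  have [h1 h2] := sidewise_step (unit_interval j) (rho_gt0 j) b0
     (elastic_dp H j) (elastic_dq H j) (elastic_L2 H j).
  have h3 : 2 / rho j * sqnorm j%:R j.+1%:R (f j) <= c.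
    rewrite /c -!mulrA ler_wpM2l // ler_pM ?invr_ge0 ?sqnorm_ge0 ?compliance_ge //.
      by rewrite ltW.
    exact: sqnorm_le_N.
  rewrite -/(e j) in h1 h2; rewrite -/(residN beta p s j) -/f in h1 h2.
  by split; [apply: le_trans h1 _|apply: le_trans h2 _]; rewrite ler_wpM2l // /e lerD2l.
have chain j : e j j%:R + c <= (3 * kappa) ^+ N * (e j0 j0%:R + c).
  apply: (@chain_growth (fun j => e j j%:R) (fun j => e j j.+1%:R)) => //.
  - by move=> k; exact: (step k).2.
  move=> i k ki; rewrite -ki /e (elastic_p_joint H ki).
  have := elastic_q_joint H ki; set u := q i _; set v := q k _; set w := p k _.
  case: u => u1 u2; case: v => v1 v2 /= []; rewrite !mul0r !subr0 !addr0 => E1 E2.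
  have Ev (a b : R) : rho i * a = rho k * b -> rho k * b ^+ 2 <= kappa * (rho i * a ^+ 2).
    move=> E; have -> : b = rho i / rho k * a.
      by rewrite mulrAC E mulrC mulKf // lt0r_neq0.
    have -> : rho k * (rho i / rho k * a) ^+ 2 = rho i / rho k * (rho i * a ^+ 2).
      by field; rewrite lt0r_neq0.
    by rewrite ler_wpM2r // mulr_ge0 ?sqr_ge0 // ltW.
  have h : 0 <= (kappa - 1) * (beta * (Re w ^+ 2 + Im w ^+ 2)).
    by apply: mulr_ge0; [lra|apply: mulr_ge0 => //; rewrite addr_ge0 ?sqr_ge0].
  by have := Ev _ _ E1; have := Ev _ _ E2; lra.
have start : e j0 j0%:R <= (compliance + beta) * trace2 j0 p.
  rewrite /e /trace2 j00; have := elastic_left H j00.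
  case: (q j0 0) => u1 u2; case: (p j0 0) => v1 v2 /= [].
  rewrite !mul0r !mul1r !addr0 subr0 sub0r add0r => E1 E2.
  have rz := lt0r_neq0 (rho_gt0 j0).
  have -> : u1 = - v2 / rho j0 by rewrite -E1 mulrC mulKf.
  have -> : u2 = v1 / rho j0 by rewrite -E2 mulrC mulKf.
  have -> : rho j0 * ((- v2 / rho j0) ^+ 2 + (v1 / rho j0) ^+ 2) =
    (rho j0)^-1 * (v1 ^+ 2 + v2 ^+ 2) by field.
  by rewrite mulrDl lerD2r ler_wpM2r ?addr_ge0 ?sqr_ge0 // compliance_ge.
have pe j : beta * sqnorm j%:R j.+1%:R (p j) <= itg j%:R j.+1%:R (e j).
  have Ip := intg_sqnorm (cac_L2 (elastic_dp H j)).
  have Iq := intg_sqnorm (cac_L2 (elastic_dq H j)).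
  rewrite -itgZ //; apply: le_itg; [exact: intgZ|by apply: intgD; exact: intgZ|].
  by move=> x _; rewrite lerDr mulr_ge0 ?addr_ge0 ?sqr_ge0 // ltW.
have k0 : 0 <= (3 * kappa) ^+ N by rewrite exprn_ge0 //; lra.
apply: (@le_trans _ _ (\sum_(j < N) (2 * ((3 * kappa) ^+ N * (e j0 j0%:R + c))))).
  rewrite /sqnormN mulr_sumr; apply: ler_sum => j _.
  apply: le_trans (pe j) _; apply: le_trans (step j).1 _.
  by rewrite ler_wpM2l.
rewrite sumr_const card_ord -[leLHS]mulr_natl -!mulrA !ler_wpM2l //.
by rewrite /c -/f -/B -!mulrA lerD2r.
Qed.

Lemma AMGM_le (t u v : R) : 0 < t -> `|u * v| <= t * v ^+ 2 + u ^+ 2 / (4 * t).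
Proof.
move=> t0.
have P : 0 <= (u - 2 * t * v) ^+ 2 / (4 * t) by rewrite divr_ge0 ?sqr_ge0 // mulr_ge0 // ltW.
have Q : 0 <= (u + 2 * t * v) ^+ 2 / (4 * t) by rewrite divr_ge0 ?sqr_ge0 // mulr_ge0 // ltW.
have E1 : (u - 2 * t * v) ^+ 2 / (4 * t) = t * v ^+ 2 + u ^+ 2 / (4 * t) - u * v.
  by field; rewrite gt_eqF.
have E2 : (u + 2 * t * v) ^+ 2 / (4 * t) = t * v ^+ 2 + u ^+ 2 / (4 * t) + u * v.
  by field; rewrite gt_eqF.
rewrite E1 in P; rewrite E2 in Q.
by rewrite ler_norml; apply/andP; split; lra.
Qed.

Lemma itg_pair_le j (f p : R -> R[i]) (t : R) : 0 < t ->
  L2 j%:R j.+1%:R f -> L2 j%:R j.+1%:R p ->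
  `|itg j%:R j.+1%:R (fun x => Re (f x) * Re (p x) + Im (f x) * Im (p x))| <=
    t * sqnorm j%:R j.+1%:R p + sqnorm j%:R j.+1%:R f / (4 * t) /\
  `|itg j%:R j.+1%:R (fun x => Im (f x) * Re (p x) - Re (f x) * Im (p x))| <=
    t * sqnorm j%:R j.+1%:R p + sqnorm j%:R j.+1%:R f / (4 * t).
Proof.
move=> t0 Lf Lp; have If := intg_sqnorm Lf; have Ip := intg_sqnorm Lp.
have -> : t * sqnorm j%:R j.+1%:R p + sqnorm j%:R j.+1%:R f / (4 * t) =
  itg j%:R j.+1%:R (fun x => t * (Re (p x) ^+ 2 + Im (p x) ^+ 2) +
     (4 * t)^-1 * (Re (f x) ^+ 2 + Im (f x) ^+ 2)).
  by rewrite itgD ?itgZ //; [congr (_ + _); exact: mulrC| |]; exact: intgZ.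
have I3 := intgD (intgZ t Ip) (intgZ (4 * t)^-1 If).
have /L2P[f1 f2] := Lf; have /L2P[p1 p2] := Lp.
have I1 := intgD (L2r_mul f1 p1) (L2r_mul f2 p2).
have I2 := intgB (L2r_mul f2 p1) (L2r_mul f1 p2).
split; [rewrite (le_trans (le_norm_itg I1)) //|rewrite (le_trans (le_norm_itg I2)) //];
  (apply: le_itg; [exact: intg_norm|exact: I3|]) => x _.
- rewrite (le_trans (ler_normD _ _)) //.
  have := AMGM_le (Re (f x)) (Re (p x)) t0; have := AMGM_le (Im (f x)) (Im (p x)) t0; lra.
- rewrite (le_trans (ler_normB _ _)) //.
  have := AMGM_le (Re (f x)) (Im (p x)) t0; have := AMGM_le (Im (f x)) (Re (p x)) t0; lra.
Qed.

Lemma elastic_resid_L2 (beta : R) p q s j : elastic rho p q s ->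
  L2 j%:R j.+1%:R (residN beta p s j).
Proof.
move=> H; apply: resid_L2; [exact: cac_L2 (elastic_dp H j)|exact: elastic_L2 H j].
Qed.

(** Real part of the pairing of the residual with [p]: i beta |p|^2 drops out, the fluxes cancel at
    the joints and vanish at x = N, and rho q = i p makes the flux at 0 equal to |p(0)|^2. *)
Lemma trace_identity (beta : R) p q s j0 : elastic rho p q s -> j0 = 0%N :> nat ->
  trace2 j0 p = \sum_(j < N) itg j%:R j.+1%:R (fun x =>
    Re (residN beta p s j x) * Re (p j x) + Im (residN beta p s j x) * Im (p j x)).
Proof.
move=> H j00.
pose W j (x : R) := rho j * (Im (q j x) * Re (p j x) - Re (q j x) * Im (p j x)).
have := @network_telescope W j0 j00.
have hW1 j k : k = j.+1 :> nat -> W j k%:R = W k k%:R.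
  move=> kj; rewrite /W (elastic_p_joint H kj); have := elastic_q_joint H kj.
  case: (q j _) => u1 u2; case: (q k _) => v1 v2; case: (p k _) => w1 w2 /= [].
  rewrite !mul0r !subr0 !addr0 => E1 E2.
  by rewrite !mulrBr !mulrA E1 E2.
have hW2 j : j.+1 = N -> W j N%:R = 0.
  by move=> jN; rewrite /W (elastic_right H jN) /= !mulr0 subr0 mulr0.
move=> /(_ hW1 hW2).
have -> : W j0 0 = trace2 j0 p.
  rewrite /W /trace2; have := elastic_left H j00.
  case: (q j0 0) => u1 u2; case: (p j0 0) => v1 v2 /= [].
  rewrite !mul0r !mul1r !addr0 subr0 sub0r add0r => E1 E2.
  by rewrite mulrBr !mulrA E1 E2; ring.
move=> E; rewrite -[LHS]opprK -E -sumrN; apply: eq_bigr => j _.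
have jj : j%:R <= j.+1%:R :> R by rewrite ler_nat.
by have [-> _] := flux_identity (rho j) beta jj (elastic_dp H j) (elastic_dq H j) (elastic_L2 H j).
Qed.

(** Imaginary part of the same pairing. The flux at 0 is now Re(i |p(0)|^2) = 0, so no boundary term
    survives. *)
Lemma elastic_identity (beta : R) p q s : elastic rho p q s ->
  \sum_(j < N) rho j * sqnorm j%:R j.+1%:R (q j) =
  beta * sqnormN p - \sum_(j < N) itg j%:R j.+1%:R (fun x =>
    Im (residN beta p s j x) * Re (p j x) - Re (residN beta p s j x) * Im (p j x)).
Proof.
move=> H.
pose Z j (x : R) := rho j * (Re (q j x) * Re (p j x) + Im (q j x) * Im (p j x)).
have [N0|N0] := posnP N.
  have e0 (f : 'I_N -> R) : \sum_(j < N) f j = 0.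
    by rewrite big1 // => -[n hn]; exfalso; rewrite N0 in hn.
  by rewrite /sqnormN !e0 mulr0 subr0.
pose j0 := Ordinal N0.
have := @network_telescope Z j0 erefl.
have hW1 j k : k = j.+1 :> nat -> Z j k%:R = Z k k%:R.
  move=> kj; rewrite /Z (elastic_p_joint H kj); have := elastic_q_joint H kj.
  case: (q j _) => u1 u2; case: (q k _) => v1 v2; case: (p k _) => w1 w2 /= [].
  rewrite !mul0r !subr0 !addr0 => E1 E2.
  by rewrite !mulrDr !mulrA E1 E2.
have hW2 j : j.+1 = N -> Z j N%:R = 0.
  by move=> jN; rewrite /Z (elastic_right H jN) /= !mulr0 addr0 mulr0.
move=> /(_ hW1 hW2).
have -> : Z j0 0 = 0.
  rewrite /Z; have := elastic_left H (erefl : j0 = 0%N :> nat).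
  case: (q j0 0) => u1 u2; case: (p j0 0) => v1 v2 /= [].
  rewrite !mul0r !mul1r !addr0 subr0 sub0r add0r => E1 E2.
  by rewrite mulrDr !mulrA E1 E2; ring.
rewrite oppr0 => E; rewrite /sqnormN mulr_sumr -sumrB.
rewrite -[LHS]subr0 -[X in _ - X = _]E -sumrB; apply: eq_bigr => j _.
have jj : j%:R <= j.+1%:R :> R by rewrite ler_nat.
by have [_ ->] := flux_identity (rho j) beta jj (elastic_dp H j) (elastic_dq H j) (elastic_L2 H j).
Qed.

(* For [beta] below the spectral gap the elastic energy absorbs [beta |p|^2] by
   Poincare; above it the sidewise energy is coercive. *)
Theorem resolvent_bound : exists2 M : R, 0 < M & forall (beta : R) p q s,
  elastic rho p q s -> sqnormN p <= M * sqnormN (residN beta p s).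
Proof.
have [N0|N0] := posnP N.
  exists 1 => // beta p q s _.
  by rewrite mul1r /sqnormN !big1 // => -[n hn]; exfalso; rewrite N0 in hn.
pose j0 := Ordinal N0.
have [K K1 HK] := poincare; have [G G0 HG] := sidewise.
pose sigma := compliance; have s0 : 0 <= sigma := compliance_ge0.
(* If 2 K beta >= 1 then sigma <= 2 K sigma beta, hence G (sigma + beta) <= beta G (2 K sigma + 1):
   once [beta] is divided out of [sidewise], [Hc] bounds the coefficient of the trace. The last 1
   makes [Hc] positive. *)
pose Hc : R := G * (2 * K * sigma + 1) + 1.
have Hc0 : 0 < Hc by rewrite ltr_wpDl // mulr_ge0 // addr_ge0 // !mulr_ge0 //; lra.
have K0 : 0 < K by lra.
(* With A = |p|^2, B = |residual|^2 and T = |p(0)|^2: for 2 K beta <= 1 one gets A <= A/2 + A/4 +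
   K^2 B, which gives 4 K^2. Otherwise A <= Hc T + 4 K G sigma B with Hc T <= A/2 + Hc^2 B/2, which
   gives the other two terms. *)
exists (4 * K ^+ 2 + Hc ^+ 2 + 8 * K * G * sigma).
  have : 0 <= K * G * sigma by rewrite !mulr_ge0 // ltW.
  have : 0 < K ^+ 2 by rewrite exprn_gt0.
  have : 0 < Hc ^+ 2 by rewrite exprn_gt0.
  lra.
move=> beta p q s H; set A := sqnormN p; set B := sqnormN _.
have A0 : 0 <= A by exact: sqnormN_ge0.
have B0 : 0 <= B by exact: sqnormN_ge0.
have KGs : 0 <= K * G * sigma by rewrite !mulr_ge0 // ltW.
pose D := \sum_(j < N) rho j * sqnorm j%:R j.+1%:R (q j).
have trT t : 0 < t -> trace2 j0 p <= t * A + B / (4 * t).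
  move=> t0; rewrite (trace_identity beta H (erefl : j0 = 0%N :> nat)).
  rewrite /A /B /sqnormN mulr_sumr mulr_suml -big_split /=; apply: ler_sum => j _.
  apply: le_trans (ler_norm _) _.
  exact: (itg_pair_le t0 (elastic_resid_L2 _ _ H) (cac_L2 (elastic_dp H j))).1.
have elD t : 0 < t -> D <= beta * A + (t * A + B / (4 * t)).
  move=> t0; rewrite /D (elastic_identity beta H) lerD2l -sumrN.
  rewrite /A /B /sqnormN mulr_sumr mulr_suml -big_split /=; apply: ler_sum => j _.
  apply: le_trans (ler_norm _) _; rewrite normrN.
  exact: (itg_pair_le t0 (elastic_resid_L2 _ _ H) (cac_L2 (elastic_dp H j))).2.
have AK := HK _ _ _ H; rewrite -/A -/D in AK.
have HB : 0 <= Hc ^+ 2 * B by rewrite mulr_ge0 // sqr_ge0.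
have KB : 0 <= K ^+ 2 * B by rewrite mulr_ge0 // sqr_ge0.
have [bK|bK] := leP (2 * K * beta) 1.
  have t0 : 0 < (4 * K)^-1 by rewrite invr_gt0; lra.
  have := ler_wpM2l (ltW K0) (elD _ t0).
  have -> : B / (4 * (4 * K)^-1) = K * B by field; rewrite gt_eqF.
  have -> : K * (beta * A + ((4 * K)^-1 * A + K * B)) = (K * beta) * A + A / 4 + K ^+ 2 * B.
    by field; rewrite gt_eqF.
  have : 0 <= (1 - 2 * K * beta) * A by rewrite mulr_ge0 // subr_ge0.
  have := mulr_ge0 KGs B0.
  by rewrite !mulrDl; lra.
have b0 : 0 < beta by rewrite -(pmulr_rgt0 beta (_ : 0 < 2 * K)); lra.
have := HG beta p q s j0 (ltW b0) H erefl; rewrite -/A -/B -/sigma.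
set T := trace2 j0 p => bA.
have T0 : 0 <= T by rewrite addr_ge0 ?sqr_ge0.
have t0 : 0 < (2 * Hc)^-1 by rewrite invr_gt0; lra.
have := trT _ t0; rewrite -/T.
have -> : B / (4 * (2 * Hc)^-1) = Hc * B / 2 by field; rewrite gt_eqF.
move=> /(ler_wpM2l (ltW Hc0)).
have -> : Hc * ((2 * Hc)^-1 * A + Hc * B / 2) = A / 2 + Hc ^+ 2 * B / 2.
  by field; rewrite gt_eqF.
move=> HT.
have bA' : beta * A <= beta * (Hc * T + 4 * K * G * sigma * B).
  apply: le_trans bA _.
  have h1 : 0 <= (2 * K * beta - 1) * (G * sigma * T).
    by rewrite !mulr_ge0 // subr_ge0 ltW.
  have h2 : 0 <= (2 * K * beta - 1) * (2 * G * sigma * B).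
    by rewrite !mulr_ge0 // subr_ge0 ltW.
  have h3 : 0 <= beta * T by rewrite mulr_ge0 // ltW.
  by rewrite /Hc; lra.
rewrite ler_pM2l // in bA'.
by rewrite !mulrDl; lra.
Qed.

End network_estimates.

(** * Semi-inner product spaces and the finite Fourier transform *)

Section semi_inner_product.
Context {R : realType} (V : lmodType R[i]) (ip : V -> V -> R[i]).
Local Open Scope complex_scope.
Local Open Scope ring_scope.
Local Notation Re := (@complex.Re R).
Local Notation Im := (@complex.Im R).
Hypothesis ipDl : forall x y z, ip (x + y) z = ip x z + ip y z.
Hypothesis ipZl : forall (a : R[i]) x y, ip (a *: x) y = a * ip x y.
Hypothesis ipC : forall x y, ip y x = (ip x y)^*.
Hypothesis ip_ge0 : forall x, 0 <= Re (ip x x).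
Implicit Types (x y z : V) (a b d h s t : R).

Definition rip x y : R := Re (ip x y).
Definition nrm2 x : R := rip x x.
Definition nrm x : R := Num.sqrt (nrm2 x).
Definition rscale t x : V := t%:C *: x.

Lemma ReM_real t (c : R[i]) : Re (t%:C * c) = t * Re c.
Proof. by case: c => u v /=; rewrite mul0r subr0. Qed.

Lemma ripC x y : rip x y = rip y x.
Proof. by rewrite /rip [ip y x]ipC; case: (ip x y). Qed.

Lemma ripDl x y z : rip (x + y) z = rip x z + rip y z.
Proof. by rewrite /rip ipDl; case: (ip x z); case: (ip y z). Qed.

Lemma ripDr x y z : rip z (x + y) = rip z x + rip z y.
Proof. by rewrite ripC ripDl ![rip _ z]ripC. Qed.

Lemma ripZl t x y : rip (rscale t x) y = t * rip x y.
Proof. by rewrite /rip /rscale ipZl ReM_real. Qed.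

Lemma ripZr t x y : rip x (rscale t y) = t * rip x y.
Proof. by rewrite ripC ripZl ripC. Qed.

Lemma rscaleN1 x : rscale (-1) x = - x.
Proof. by rewrite /rscale rmorphN1 scaleN1r. Qed.

Lemma rscaleDr t x y : rscale t (x + y) = rscale t x + rscale t y.
Proof. by rewrite /rscale scalerDr. Qed.

Lemma rscaleBr t x y : rscale t (x - y) = rscale t x - rscale t y.
Proof. by rewrite /rscale scalerBr. Qed.

Lemma ripNl x y : rip (- x) y = - rip x y.
Proof. by rewrite -rscaleN1 ripZl mulN1r. Qed.

Lemma ripNr x y : rip x (- y) = - rip x y.
Proof. by rewrite ripC ripNl ripC. Qed.

Lemma nrm2_ge0 x : 0 <= nrm2 x. Proof. exact: ip_ge0. Qed.
Lemma nrm_ge0 x : 0 <= nrm x. Proof. exact: sqrtr_ge0. Qed.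
Lemma sqr_nrm x : nrm x ^+ 2 = nrm2 x.
Proof. by rewrite sqr_sqrtr // nrm2_ge0. Qed.

Lemma nrm2D x y : nrm2 (x + y) = nrm2 x + 2 * rip x y + nrm2 y.
Proof. by rewrite /nrm2 ripDl !ripDr [rip y x]ripC; ring. Qed.

Lemma nrm2Z t x : nrm2 (rscale t x) = t ^+ 2 * nrm2 x.
Proof. by rewrite /nrm2 ripZl ripZr; ring. Qed.

Lemma nrm2N x : nrm2 (- x) = nrm2 x.
Proof. by rewrite /nrm2 ripNl ripNr opprK. Qed.

Lemma nrmN x : nrm (- x) = nrm x.
Proof. by rewrite /nrm nrm2N. Qed.

Lemma nrmZ t x : nrm (rscale t x) = `|t| * nrm x.
Proof. by rewrite /nrm nrm2Z sqrtrM ?sqr_ge0 // sqrtr_sqr. Qed.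

Lemma rip_le x y : rip x y <= nrm x * nrm y.
Proof.
have H t : 0 <= nrm2 x * t ^+ 2 - 2 * rip x y * t + nrm2 y.
  have := nrm2_ge0 (rscale (- t) x + y).
  by rewrite nrm2D nrm2Z ripZl; congr (_ <= _); ring.
have [|xy0] := leP (rip x y) 0.
  by move=> /le_trans; apply; rewrite mulr_ge0 ?nrm_ge0.
rewrite -ler_sqr ?nnegrE ?(ltW xy0) ?mulr_ge0 ?nrm_ge0 // exprMn !sqr_nrm.
have := nrm2_ge0 x; rewrite le_eqVlt => /predU1P[x0|x0].
  (* For a null [x] the quadratic in H is affine; at this parameter it equals -1. *)
  have := H ((nrm2 y + 1) / (2 * rip x y)).
  rewrite -x0 mul0r sub0r mulrC divfK ?lt0r_neq0 ?mulr_gt0 //.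
  by move=> ?; exfalso; lra.
have := H (rip x y / nrm2 x).
have -> : nrm2 x * (rip x y / nrm2 x) ^+ 2 - 2 * rip x y * (rip x y / nrm2 x) + nrm2 y =
  nrm2 y - rip x y ^+ 2 / nrm2 x by field; rewrite lt0r_neq0.
by rewrite subr_ge0 ler_pdivrMr // mulrC.
Qed.

Lemma nrm_tri x y : nrm (x + y) <= nrm x + nrm y.
Proof.
rewrite -ler_sqr ?nnegrE ?addr_ge0 ?nrm_ge0 // sqr_nrm nrm2D sqrrD !sqr_nrm.
by have := rip_le x y; lra.
Qed.

Lemma nrm_triB x y : nrm (x - y) <= nrm x + nrm y.
Proof. by rewrite (le_trans (nrm_tri _ _)) // nrmN. Qed.

Lemma nrm_sub_le x y : nrm x <= nrm y + nrm (x - y).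
Proof. by have := nrm_tri y (x - y); rewrite addrC subrK. Qed.

Lemma nrm_distC x y : nrm (x - y) = nrm (y - x).
Proof. by rewrite -nrmN opprB. Qed.

Lemma Re_sum n (F : 'I_n -> R[i]) : Re (\sum_(k < n) F k) = \sum_(k < n) Re (F k).
Proof. by elim/big_rec2: _ => [//|k u v _ <-]; case: (F k) => a b; case: v. Qed.

Lemma ip_sum0 n (F : 'I_n -> V) y : ip (\sum_(k < n) F k) y = \sum_(k < n) ip (F k) y.
Proof.
have ip0 z : ip 0 z = 0 by rewrite -(scale0r 0) ipZl mul0r.
by elim/big_rec2: _ => [|k u v _ <-]; [exact: ip0|rewrite ipDl].
Qed.

Lemma ip_sum n (F : 'I_n -> V) :
  ip (\sum_(k < n) F k) (\sum_(k < n) F k) = \sum_(k < n) \sum_(l < n) ip (F k) (F l).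
Proof.
rewrite ip_sum0; apply: eq_bigr => k _.
by rewrite ipC ip_sum0 rmorph_sum; apply: eq_bigr => l _; rewrite [in RHS]ipC.
Qed.

(** X^n - 1 splits over the algebraically closed field [R[i]] and is separable in characteristic 0,
    so it has n distinct roots, enough for a primitive one. *)
Lemma prim_root_exists n : (0 < n)%N -> exists w : R[i], n.-primitive_root w.
Proof.
move=> n_gt0; pose p : {poly R[i]} := 'X^n - 1.
have [r Dp] := closed_field_poly_normal p.
rewrite (monicP _) ?monicXnsubC // scale1r in Dp.
have rn1 : all n.-unity_root r by apply/allP=> z; rewrite -root_prod_XsubC -Dp.
have sz_r : (n < (size r).+1)%N.
  by rewrite -(size_prod_XsubC r id) -Dp size_XnsubC.
have [|z] := hasP (has_prim_root n_gt0 rn1 _ sz_r); last by exists z.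
by rewrite -separable_prod_XsubC -Dp separable_Xn_sub_1 // pnatr_eq0 -lt0n.
Qed.

Section fourier.
Variables (n : nat) (w : R[i]).
Hypothesis n_gt0 : (0 < n)%N.
Hypothesis prim_w : n.-primitive_root w.

Definition dft (y : nat -> V) (m : nat) : V := \sum_(k < n) (w ^+ m) ^+ k *: y k.

Lemma prim_root_norm1 : `|w| = 1.
Proof.
have := prim_expr_order prim_w => /(congr1 Num.norm); rewrite normrX normr1 => /eqP.
by rewrite pexpr_eq1 // => /eqP.
Qed.

Lemma prim_root_conj : w^* = w^-1.
Proof. by rewrite invc_norm prim_root_norm1 expr1n invr1 mul1r. Qed.

(** Orthogonality of characters: as conj w = w^-1, this is a geometric sum of ratio w^(k - l), which
    differs from 1 for k <> l while its n-th power is 1. *)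
Lemma character_sum (k l : 'I_n) :
  \sum_(m < n) (w ^+ m) ^+ k * ((w ^+ m) ^+ l)^* = if k == l then n%:R else 0.
Proof.
have w0 : w != 0 by rewrite (prim_root_eq0 prim_w) -lt0n.
rewrite (eq_bigr (fun m : 'I_n => (w ^+ k / w ^+ l) ^+ m)); last first.
  move=> m _; rewrite !rmorphXn /= prim_root_conj exprMn -exprVn -!exprM.
  by rewrite [(k * m)%N]mulnC [(l * m)%N]mulnC.
case: eqVneq => [->|kl].
  rewrite (eq_bigr (fun=> 1)); first by rewrite sumr_const card_ord.
  by move=> m _; rewrite divff ?expr1n // expf_neq0.
have c1 : w ^+ k / w ^+ l - 1 != 0.
  rewrite subr_eq0; apply: contraNneq kl => E.
  have : w ^+ k = w ^+ l by rewrite -[RHS]mul1r -E divfK // expf_neq0.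
  by move/eqP; rewrite (eq_prim_root_expr prim_w) !modn_small.
apply: (mulfI c1); rewrite mulr0 -subrX1 exprMn -exprVn -!exprM.
rewrite [(k * n)%N]mulnC [(l * n)%N]mulnC !exprM [w^-1 ^+ n]exprVn.
by rewrite (prim_expr_order prim_w) invr1 !expr1n mulr1 subrr.
Qed.

Lemma parseval (y : nat -> V) : \sum_(m < n) nrm2 (dft y m) = n%:R * \sum_(k < n) nrm2 (y k).
Proof.
rewrite /nrm2 /rip -Re_sum mulr_sumr.
have -> : \sum_(m < n) ip (dft y m) (dft y m) = \sum_(k < n) n%:R * ip (y k) (y k).
  rewrite (eq_bigr _ (fun m _ => ip_sum _)) exchange_big; apply: eq_bigr => k _ /=.
  rewrite exchange_big /= (bigD1 k) //= [X in _ + X]big1 ?addr0 => [|l lk].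
    rewrite (eq_bigr (fun m : 'I_n => ((w ^+ m) ^+ k * ((w ^+ m) ^+ k)^*) * ip (y k) (y k))).
      by rewrite -mulr_suml character_sum eqxx.
    by move=> m _; rewrite ipZl ipC ipZl rmorphM /= -ipC mulrA.
  rewrite (eq_bigr (fun m : 'I_n => ((w ^+ m) ^+ k * ((w ^+ m) ^+ l)^*) * ip (y k) (y l))).
    by rewrite -mulr_suml character_sum eq_sym (negbTE lk) mul0r.
  by move=> m _; rewrite ipZl ipC ipZl rmorphM /= -ipC mulrA.
rewrite Re_sum; apply: eq_bigr => k _.
by have -> : n%:R = (n%:R)%:C :> R[i] by [rewrite rmorph_nat]; rewrite ReM_real.
Qed.

End fourier.

(** * Dissipative linear relations and decay of their C^1 curves *)

Section dissipative_graph.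
Variables (Gr : V -> V -> Prop) (M : R).
Hypothesis Gr_lin : forall (a : R[i]) x F y G, Gr x F -> Gr y G -> Gr (a *: x + y) (a *: F + G).
Hypothesis Gr0 : Gr 0 0.
Hypothesis Gr_dissipative : forall x F, Gr x F -> rip F x <= 0.
Hypothesis M_ge0 : 0 <= M.
Hypothesis Gr_resolvent : forall (beta : R) x F, Gr x F ->
  nrm2 x <= M * nrm2 ((0 +i* beta) *: x - F).

(** Let g be the residual at i Im lambda. Dissipativity and Re <x, i beta x> = 0 give Re <x, g> >=
    0, so passing from g to Re lambda x + g cannot decrease the norm. *)
Lemma Gr_resolvent_right (lambda : R[i]) x F : 0 <= Re lambda -> Gr x F ->
  nrm2 x <= M * nrm2 (lambda *: x - F).
Proof.
move=> l0 xF; apply: le_trans (Gr_resolvent (Im lambda) xF) _.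
rewrite ler_wpM2l //; set g := _ *: x - F.
have -> : lambda *: x - F = rscale (Re lambda) x + g.
  rewrite /rscale /g addrA -scalerDl; congr (_ *: _ - _).
  by case: (lambda) => u v /=; rewrite /GRing.add /= addr0 add0r.
rewrite nrm2D nrm2Z ripZl.
have xg : 0 <= rip x g.
  rewrite /g ripDr ripNr [rip x F]ripC.
  have -> : rip x ((0 +i* Im lambda) *: x) = 0.
    rewrite ripC /rip ipZl; have := ipC x x; case: (ip x x) => u v [] /= v0.
    have {}v0 : v = 0 by lra.
    by rewrite v0 mul0r mulr0 subr0.
  by rewrite add0r oppr_ge0 Gr_dissipative.
have := mulr_ge0 l0 xg; have := mulr_ge0 (sqr_ge0 (Re lambda)) (nrm2_ge0 x); lra.
Qed.

Lemma Gr_sum n (c : 'I_n -> R[i]) (x F : 'I_n -> V) : (forall k, Gr (x k) (F k)) ->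
  Gr (\sum_(k < n) c k *: x k) (\sum_(k < n) c k *: F k).
Proof.
by move=> H; elim/big_rec2: _ => // k u v _ IH; apply: Gr_lin.
Qed.

(* Implicit Euler for an n-periodic sequence: on the m-th Fourier mode the difference
   quotient acts as [(1 - w ^ m) / h], which has nonnegative real part. *)
Lemma discrete_resolvent n (h : R) (y F f : nat -> V) : (0 < n)%N -> 0 < h ->
  (forall k, (k < n)%N -> Gr (y k.+1) (F k)) -> y n = y 0%N ->
  (forall k, (k < n)%N -> y k.+1 - y k = rscale h (F k + f k)) ->
  \sum_(k < n) nrm2 (y k.+1) <= M * \sum_(k < n) nrm2 (f k).
Proof.
move=> n0 h0 yF yn yf; have [w prim_w] := prim_root_exists n0.
have nR : 0 < n%:R :> R by rewrite ltr0n.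
rewrite -(ler_pM2l nR) mulrCA -(parseval n0 prim_w (fun k => y k.+1)) -(parseval n0 prim_w f).
rewrite mulr_sumr; apply: ler_sum => m _.
set c := w ^+ m; set Y := dft n w _ m.
have hC : h%:C != 0 by rewrite eq_complex /= gt_eqF.
have hF : Gr Y (dft n w F m) by apply: Gr_sum => k; exact: yF.
have cn : c ^+ n = 1 by rewrite /c -exprM mulnC exprM (prim_expr_order prim_w) expr1n.
have cY : \sum_(k < n) c ^+ k *: y k = c *: Y.
  rewrite /Y /dft scaler_sumr.
  rewrite [RHS](eq_bigr (fun k : 'I_n => c ^+ k.+1 *: y k.+1)); last first.
    by move=> k _; rewrite scalerA -exprS.
  (* One sum of [n.+1] terms, split at its last index on the left and at its first on the right; the
     two extra terms agree because [c ^+ n = 1] and [y n = y 0]. *)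
  have E : \sum_(k < n.+1) c ^+ k *: y k = \sum_(k < n.+1) c ^+ k *: y k by [].
  rewrite {1}big_ord_recr big_ord_recl /= cn yn expr0 addrC in E.
  by move/addrI: E.
have -> : dft n w f m = ((1 - c) / h%:C) *: Y - dft n w F m.
  have E : h%:C *: (dft n w F m + dft n w f m) = Y - c *: Y.
    rewrite -cY /Y /dft -sumrB -big_split scaler_sumr /=; apply: eq_bigr => k _.
    rewrite -scalerBr yf // /rscale !scalerDr !scalerA.
    by rewrite ![h%:C * _]mulrC.
  rewrite mulrC -scalerA scalerBl scale1r -E scalerA mulVf // scale1r.
  by rewrite addrC addKr.
apply: Gr_resolvent_right hF.
have -> : Re ((1 - c) / h%:C) = (1 - Re c) / h.
  have -> : (1 - c) / h%:C = (h^-1)%:C * (1 - c) by rewrite fmorphV mulrC.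
  by rewrite ReM_real mulrC; case: (c).
rewrite divr_ge0 ?(ltW h0) // subr_ge0.
have c1 : `|c| = 1 by rewrite normrX (prim_root_norm1 n0 prim_w) expr1n.
have := normc_ge_Re c; rewrite c1 -(rmorph1 (real_complex R)) lecR.
by apply: le_trans; exact: ler_norm.
Qed.
Lemma dissipative_expand h x F : 0 <= h -> Gr x F -> nrm x <= nrm (x - rscale h F).
Proof.
move=> h0 xF; rewrite -ler_sqr ?nnegrE ?nrm_ge0 // !sqr_nrm nrm2D nrm2N ripNr ripZr.
rewrite [rip x F]ripC; have := mulr_ge0 h0 (_ : 0 <= - rip F x).
by rewrite oppr_ge0 => /(_ (Gr_dissipative xF)); have := nrm2_ge0 (rscale h F); lra.
Qed.

(** Differentiability uniform on bounded time intervals, with the derivative taken at the right end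
    of the step, as an implicit Euler scheme requires. *)
Definition C1curve (U G : R -> V) : Prop :=
  (forall t, 0 <= t -> Gr (U t) (G t)) /\
  forall T e : R, 0 < e -> exists2 d : R, 0 < d & forall s t, 0 <= s -> s <= t -> t <= T ->
    t - s < d -> nrm (U t - U s - rscale (t - s) (G t)) <= e * (t - s).

(** For a step h from x to y, |U y| <= |U y - h G y| <= |U x| + e h, the first inequality by
    dissipativity; [partition_le] sums the errors. *)
Lemma curve_contraction U G s t : C1curve U G -> 0 <= s -> s <= t ->
  nrm (U t) <= nrm (U s).
Proof.
move=> [UG dU] s0 st.
apply: (partition_le (H := fun r => nrm (U r)) (m := fun r => r) st) => e e0.
have [d d0 Hd] := dU t e e0; exists d => // x y sx xy yt yx.
have x0 : 0 <= x := le_trans s0 sx.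
have h0 : 0 <= y - x by rewrite subr_ge0.
have A := dissipative_expand h0 (UG y (le_trans x0 xy)).
have B := Hd x y x0 xy yt yx.
have C := nrm_tri (U x) (U y - U x - rscale (y - x) (G y)).
rewrite addrC -addrA addrCA addrNK addrC in C.
by move: A B C; set X := nrm (_ - rscale _ _); lra.
Qed.

Lemma tent_step n k : (k < n)%N ->
  `|(minn k.+1 (n - k.+1))%:R - (minn k (n - k))%:R| <= 1 :> R.
Proof.
move=> kn; have h1 : (minn k.+1 (n - k.+1) <= (minn k (n - k)).+1)%N by lia.
have h2 : (minn k (n - k) <= (minn k.+1 (n - k.+1)).+1)%N by lia.
move: h1 h2; rewrite -!(ler_nat R) -!natr1 ler_norml => h1 h2.
by apply/andP; split; lra.
Qed.

Lemma tent_ge m k : (m <= k)%N -> (k < 3 * m)%N -> (m <= minn k.+1 (4 * m - k.+1))%N.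
Proof. by lia. Qed.

Lemma quarter_le m : (m <= 3 * m)%N /\ (3 * m <= 4 * m)%N /\ (3 * m - m = 2 * m)%N.
Proof. by lia. Qed.

(** [e] is the Euler error per unit of time. The grid has to be refined with [e], but the number of
    samples is a factor on both sides and cancels. *)
Lemma discrete_decay U G s (T e : R) : C1curve U G -> 0 <= s -> 0 < T -> 0 < e ->
  nrm2 (U (s + T)) * T ^+ 2 <= 32 * M * (T * e + nrm (U s)) ^+ 2.
Proof.
move=> HU s0 T0 e0; have [UG dU] := HU.
have [d d0 Hd] := dU (s + T) e e0.
(* A number of steps divisible by 4 puts the quarter points of the time interval on the grid. *)
have [m md] : exists m : nat, T / (4 * m.+1%:R) < d.
  exists (Num.truncn (T / d)).
  have h : T / d < (Num.truncn (T / d)).+1%:R by exact: truncnS_gt.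
  rewrite ltr_pdivrMr // in h; rewrite ltr_pdivrMr ?mulr_gt0 //.
  have : 0 < (Num.truncn (T / d)).+1%:R * d by rewrite mulr_gt0.
  by lra.
set k0 := m.+1 in md; pose n := (4 * k0)%N; pose h : R := T / n%:R.
have n0 : (0 < n)%N by rewrite /n /k0; lia.
have nR : 0 < n%:R :> R by rewrite ltr0n.
have k0R : 0 < k0%:R :> R by rewrite ltr0n.
have nk : n%:R = 4 * k0%:R :> R by rewrite /n natrM.
have h0 : 0 < h by rewrite divr_gt0.
have hd : h < d by rewrite /h nk.
have nh : n%:R * h = T by rewrite /h mulrC divfK // lt0r_neq0.
have kh : k0%:R * h = T / 4 by rewrite -nh nk; field.
pose phi (k : nat) : R := (minn k (n - k))%:R * h.
pose t (k : nat) : R := s + k%:R * h.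
have t_ge k : s <= t k by rewrite /t lerDl mulr_ge0 // ltW.
have t_le k : (k <= n)%N -> t k <= s + T.
  by move=> kn; rewrite /t lerD2l -nh ler_wpM2r ?ler_nat // ltW.
have tS k : t k.+1 - t k = h by rewrite /t -natr1; ring.
pose y k := rscale (phi k) (U (t k)).
pose F k := rscale (phi k.+1) (G (t k.+1)).
pose f k := rscale h^-1 (y k.+1 - y k) - F k.
have Gy k : (k < n)%N -> Gr (y k.+1) (F k).
  move=> _; have := @Gr_lin (phi k.+1)%:C _ _ _ _ (UG (t k.+1) _) Gr0.
  by rewrite !addr0; apply; rewrite (le_trans s0).
have yn : y n = y 0%N by rewrite /y /phi subnn minn0 min0n mul0r /rscale !scale0r.
have yf k : (k < n)%N -> y k.+1 - y k = rscale h (F k + f k).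
  move=> _; rewrite /f [F k + _]addrC subrK /rscale scalerA -rmorphM /= divff ?lt0r_neq0 //.
  by rewrite scale1r.
have := discrete_resolvent n0 h0 Gy yn yf.
set a := nrm (U s); set X := nrm2 (U (s + T)).
have a0 : 0 <= a := nrm_ge0 _.
have phi_ge0 k : 0 <= phi k by rewrite /phi mulr_ge0 // ltW.
have phi_le k : phi k <= T.
  by rewrite /phi -nh ler_wpM2r ?(ltW h0) // ler_nat geq_min leq_subr orbT.
have fk k : (k < n)%N -> nrm2 (f k) <= (T * e + a) ^+ 2.
  move=> kn; rewrite -sqr_nrm ler_sqr ?nnegrE ?nrm_ge0 ?addr_ge0 ?mulr_ge0 ?(ltW T0) ?(ltW e0) //.
  rewrite -(ler_pM2l h0) -[X in X * nrm _](gtr0_norm h0) -nrmZ.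
  (* Discrete Leibniz rule: the tent times the Euler error of U, at most T e h, plus the increment
     of the tent, at most [h], times U. *)
  have -> : rscale h (f k) = rscale (phi k.+1) (U (t k.+1) - U (t k) - rscale h (G (t k.+1)))
     + rscale (phi k.+1 - phi k) (U (t k)).
    have -> : rscale h (f k) = y k.+1 - y k - rscale h (F k).
      by rewrite yf // (rscaleDr h (F k) (f k)) addrAC subrr add0r.
    rewrite /F /y /rscale !scalerBr !scalerA rmorphB /= scalerBl [h%:C * _]mulrC.
    set A := _ *: U (t k.+1); set B := (phi k.+1)%:C *: U (t k); set D := (phi k)%:C *: _.
    by rewrite [A - B - _]addrAC addrA subrK addrAC.
  rewrite (le_trans (nrm_tri _ _)) // mulrDr; apply: lerD.
    rewrite nrmZ (ger0_norm (phi_ge0 _)).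
    have := Hd (t k) (t k.+1) (le_trans s0 (t_ge k)); rewrite tS => /(_ _ (t_le _ kn) hd) B.
    have {}B : nrm (U (t k.+1) - U (t k) - rscale h (G (t k.+1))) <= e * h.
      by apply: B; rewrite -subr_ge0 tS ltW.
    apply: (@le_trans _ _ (T * (e * h))); last by rewrite mulrA mulrC.
    by rewrite ler_pM ?nrm_ge0.
  rewrite nrmZ /phi -mulrBl normrM (gtr0_norm h0) mulrC.
  have C := curve_contraction HU s0 (t_ge k).
  rewrite mulrA mulrC ler_wpM2l ?(ltW h0) // -[leRHS]mul1r mulrC.
  by rewrite ler_pM ?nrm_ge0 ?normr_ge0 // tent_step.
move=> main.
have up : M * \sum_(k < n) nrm2 (f k) <= M * (n%:R * (T * e + a) ^+ 2).
  rewrite ler_wpM2l //; apply: (@le_trans _ _ (\sum_(k < n) (T * e + a) ^+ 2)).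
    by apply: ler_sum => k _; exact: fk.
  by rewrite sumr_const card_ord mulr_natl.
(* Only the samples of the middle half are kept. *)
have low : (2 * k0%:R) * ((T / 4) ^+ 2 * X) <= \sum_(k < n) nrm2 (y k.+1).
  rewrite -(big_mkord xpredT (fun k => nrm2 (y k.+1))).
  have [s2 [s3 s4]] := quarter_le k0; have s1 : (0 <= k0)%N by [].
  rewrite (big_cat_nat _ (leq_trans s2 s3)) //= (big_cat_nat s2 s3) //=.
  have nn (i j : nat) : 0 <= \sum_(i <= k < j) nrm2 (y k.+1).
    by apply: sumr_ge0 => k _; exact: nrm2_ge0.
  apply: (@le_trans _ _ (\sum_(k0 <= k < 3 * k0) nrm2 (y k.+1))); last first.
    by have := nn 0%N k0; have := nn (3 * k0)%N n; lra.
  have -> : 2 * k0%:R * ((T / 4) ^+ 2 * X) = \sum_(k0 <= k < 3 * k0) ((T / 4) ^+ 2 * X).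
    by rewrite sumr_const_nat s4 -[RHS]mulr_natl natrM.
  apply: ler_sum_nat => k /andP[k1 k2]; rewrite nrm2Z -kh.
  have kn : (k < n)%N by apply: leq_trans k2 s3.
  have p0 : 0 <= k0%:R * h by rewrite mulr_ge0 // ltW.
  apply: ler_pM; rewrite ?sqr_ge0 ?nrm2_ge0 //.
    rewrite ler_sqr ?nnegrE // ler_wpM2r ?(ltW h0) // ler_nat.
    exact: tent_ge.
  rewrite /X -!sqr_nrm ler_sqr ?nnegrE ?nrm_ge0 //.
  by apply: (curve_contraction HU); [rewrite (le_trans s0)|exact: t_le].
have := le_trans low (le_trans main up).
rewrite nk => H; rewrite -(ler_pM2l k0R).
have -> : k0%:R * (X * T ^+ 2) = 8 * (2 * k0%:R * ((T / 4) ^+ 2 * X)) by field.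
by apply: le_trans (ler_wpM2l (_ : 0 <= 8) H) _ => //; lra.
Qed.

Lemma curve_decay U G s (T : R) : C1curve U G -> 0 <= s -> 0 < T ->
  nrm2 (U (s + T)) * T ^+ 2 <= 32 * M * nrm2 (U s).
Proof.
move=> HU s0 T0; apply: ler_addgt0 => e1 e1_gt0.
pose a := nrm (U s); have a0 : 0 <= a := nrm_ge0 _.
(* For e <= 1, (T e + a)^2 <= a^2 + e (2 T a + T^2), so [e * D] dominates the total error. *)
pose D := 32 * M * (2 * T * a + T ^+ 2) + 1.
have D0 : 0 < D.
  by rewrite ltr_wpDl // !mulr_ge0 // addr_ge0 ?sqr_ge0 // !mulr_ge0 // ltW.
pose e := Num.min 1 (e1 / D).
have e_gt0 : 0 < e by rewrite lt_min ltr01 divr_gt0.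
have e_le1 : e <= 1 by rewrite ge_min lexx.
have e_leD : e * D <= e1 by rewrite -ler_pdivlMr // ge_min lexx orbT.
apply: le_trans (discrete_decay HU s0 T0 e_gt0) _; rewrite -/a -sqr_nrm -/a.
have h1 : e ^+ 2 <= e by rewrite expr2 ler_piMr // ltW.
have h2 : (T * e + a) ^+ 2 <= a ^+ 2 + e * (2 * T * a + T ^+ 2).
  have := ler_wpM2l (sqr_ge0 T) h1; nra.
have M32 : 0 <= 32 * M by rewrite mulr_ge0.
apply: le_trans (ler_wpM2l M32 h2) _; rewrite mulrDr lerD2l.
apply: le_trans e_leD; rewrite /D.
have -> : 32 * M * (e * (2 * T * a + T ^+ 2)) = e * (32 * M * (2 * T * a + T ^+ 2)) by ring.
by rewrite ler_wpM2l ?(ltW e_gt0) // lerDl.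
Qed.

(** * From C^1 curves to mild solutions *)

Section mild.
Variables (u v : R -> V) (u0 : V).
Hypothesis u_continuous : forall t e : R, 0 <= t -> 0 < e -> exists2 d : R, 0 < d &
  forall s, 0 <= s -> `|s - t| < d -> nrm (u s - u t) < e.
(* [v] is a primitive of [u]; this mean value inequality avoids integrals with
   values in the incomplete space [V]. *)
Hypothesis v_primitive : forall s t x (c : R), 0 <= s -> s <= t ->
  (forall r : R, s <= r -> r <= t -> nrm (u r - x) <= c) ->
  nrm (v t - v s - rscale (t - s) x) <= (t - s) * c.
Hypothesis v_graph : forall s t, 0 <= s -> 0 <= t -> Gr (v t - v s) (u t - u s).
Hypothesis v0_graph : Gr (v 0) (u 0 - u0).
Hypothesis v0_null : nrm (v 0) = 0.

Local Open Scope classical_set_scope.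

(** Heine-Cantor for the seminorm [nrm], through the covering form of compactness of [0, T]. *)
Lemma u_uniform (T e : R) : 0 < e -> exists2 d : R, 0 < d & forall s t, 0 <= s -> s <= T ->
  0 <= t -> t <= T -> `|t - s| < d -> nrm (u t - u s) < e.
Proof.
move=> e0; have e2 : 0 < e / 2 by lra.
pose P (d s : R) : Prop := 0 <= s -> s <= T -> forall t, 0 <= t -> t <= T -> `|t - s| < d ->
  nrm (u t - u s) < e.
have loc (x : R) : 0 <= x -> x <= T -> \forall x' \near x & r \near (0 : R)^'+, P r x'.
  move=> x0 xT.
  have [d d0 Hd] := u_continuous x0 e2.
  have d2 : 0 < d / 2 by lra.
  have nx : \forall x' \near x, `|x' - x| < d / 2.
    by apply: filterS (nbhsx_ballx x _ d2) => x'; rewrite -ball_normE /= distrC.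
  have nd : \forall r \near (0 : R)^'+, r < d / 2 by exact: nbhs_right_lt.
  near=> x' r; rewrite /P /= => x'0 x'T t t0 tT tx'.
  have h1 : `|x' - x| < d / 2 by near: x'; exact: nx.
  have h2 : r < d / 2 by near: r; exact: nd.
  have A : nrm (u x' - u x) < e / 2 by apply: Hd => //; lra.
  have B : nrm (u t - u x) < e / 2.
    apply: Hd => //; have := ler_normD (t - x') (x' - x).
    by rewrite addrA subrK; lra.
  have := nrm_triB (u t - u x) (u x' - u x).
  by rewrite opprB addrA subrK; lra.
have /compact_near_coveringP/(_ R (0 : R)^'+ P _) := @segment_compact R 0 T.
case=> [x|d /= d0 Hd]; first by rewrite /= in_itv /= => /andP[x0 xT]; exact: loc.
have d2 : 0 < d / 2 by lra.
exists (d / 2) => // s t s0 sT t0 tT.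
have := Hd (d / 2); rewrite /= sub0r normrN gtr0_norm //.
move=> /(_ _ d2 s); rewrite /= in_itv /= s0 sT => H; apply: H => //; lra.
Unshelve. all: by end_near. Qed.

Definition increment d t : V := v (t + d) - v t.

(** Differentiability is the difference of two instances of [v_primitive], over [s + d, t + d] and
    over [s, t], each with [u] frozen at the right endpoint and its oscillation bounded by
    [u_uniform]. *)
Lemma increment_curve d : 0 < d -> C1curve (increment d) (fun t => u (t + d) - u t).
Proof.
move=> d0; split=> [t t0|T e e0]; first by apply: v_graph => //; lra.
have e2 : 0 < e / 2 by lra.
have [r r0 Hr] := @u_uniform (T + d) _ e2.
exists r => // s t s0 st tT tsr.
have key a : 0 <= a -> a <= d ->
    nrm (v (t + a) - v (s + a) - rscale (t - s) (u (t + a))) <= (t - s) * (e / 2).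
  move=> a0 ad; have -> : t - s = t + a - (s + a) by ring.
  apply: v_primitive => [||z sz zt]; [lra|lra|].
  rewrite nrm_distC; apply/ltW/Hr; [lra|lra|lra|lra|].
  by rewrite ger0_norm; lra.
have A := key d (ltW d0) (lexx d); have B := key 0 (lexx 0) (ltW d0).
rewrite !addr0 in B.
have -> : increment d t - increment d s - rscale (t - s) (u (t + d) - u t) =
  (v (t + d) - v (s + d) - rscale (t - s) (u (t + d))) - (v t - v s - rscale (t - s) (u t)).
  rewrite /increment rscaleBr; move: (v (t + d)) (v t) (v (s + d)) (v s) => a b c f.
  move: (rscale _ (u (t + d))) (rscale _ (u t)) => p q.
  have subACA (x y z w : V) : x - y - (z - w) = x - z - (y - w).
    by rewrite !opprB !addrA [x - y + w]addrAC [_ - y - z]addrAC [x + w - z]addrAC.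
  by rewrite [a - b - _]subACA subACA.
by rewrite (le_trans (nrm_triB _ _)) //; lra.
Qed.

Lemma increment_approx t e : 0 <= t -> 0 < e -> exists2 d0 : R, 0 < d0 &
  forall d, 0 < d -> d < d0 -> nrm (increment d t - rscale d (u t)) <= d * e.
Proof.
move=> t0 e0; have [d0 d00 Hd] := u_continuous t0 e0.
exists d0 => // d dp dd0; rewrite /increment.
have := @v_primitive t (t + d) (u t) e t0; rewrite [t + d - t]addrAC subrr add0r.
apply; first by lra.
by move=> r tr rt; apply/ltW/Hd; [lra|rewrite ger0_norm; lra].
Qed.

(** For small [d] both increments lie within [d * e] of [d] times [u], so the homogeneous inequality
    can be divided by [d]. The divisor [theta + 1] shares the error between the two times. *)
Lemma increment_transfer (theta : R) s t : 0 <= theta -> 0 <= s -> 0 <= t ->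
  (forall d, 0 < d -> nrm (increment d t) <= theta * nrm (increment d s)) ->
  nrm (u t) <= theta * nrm (u s).
Proof.
move=> th0 s0 t0 H; apply: ler_addgt0 => e1 e1_gt0.
pose e := e1 / (theta + 1); have e_gt0 : 0 < e by rewrite divr_gt0 // ltr_wpDl.
have ee : e * (theta + 1) = e1 by rewrite divfK // gt_eqF // ltr_wpDl.
have [d1 d10 H1] := increment_approx s0 e_gt0.
have [d2 d20 H2] := increment_approx t0 e_gt0.
pose d := Num.min d1 d2 / 2.
have m0 : 0 < Num.min d1 d2 by rewrite lt_min d10.
have d0 : 0 < d by rewrite /d; lra.
have : d < Num.min d1 d2 by rewrite /d; lra.
rewrite lt_min => /andP[dd1 dd2].
have A := H1 d d0 dd1; have B := H2 d d0 dd2; have C := H d d0.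
have D := nrm_sub_le (rscale d (u t)) (increment d t).
have E := nrm_sub_le (increment d s) (rscale d (u s)).
rewrite nrm_distC in D.
rewrite !nrmZ (gtr0_norm d0) in D E.
have F : nrm (increment d s) <= d * nrm (u s) + d * e by lra.
have := ler_wpM2l th0 F => K.
by rewrite -(ler_pM2l d0) -ee; lra.
Qed.

Lemma mild_contraction s t : 0 <= s -> s <= t -> nrm (u t) <= nrm (u s).
Proof.
move=> s0 st; rewrite -[leRHS]mul1r; apply: increment_transfer => //; first lra.
by move=> d d0; rewrite mul1r; apply: curve_contraction (increment_curve d0) s0 st.
Qed.

(** Its square is at least 128 M + 64, more than four times the constant 32 M of [curve_decay]; the
    squared norm then falls to at most a quarter. *)
Definition halving_time : R := 8 * M + 8.

Lemma halving_time_gt0 : 0 < halving_time.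
Proof. by have := M_ge0; rewrite /halving_time; lra. Qed.

Lemma mild_halving s : 0 <= s -> nrm (u (s + halving_time)) <= 2^-1 * nrm (u s).
Proof.
move=> s0; have T0 := halving_time_gt0.
apply: increment_transfer => //; [lra|] => d d0.
have := curve_decay (increment_curve d0) s0 T0.
set X := increment d _; set Y := increment d _ => H.
rewrite -ler_sqr ?nnegrE ?mulr_ge0 ?nrm_ge0 // exprMn !sqr_nrm.
have X0 := nrm2_ge0 X; have Y0 := nrm2_ge0 Y.
have h1 : 128 * M + 64 <= halving_time ^+ 2.
  by rewrite /halving_time; have := sqr_ge0 M; lra.
have h2 := ler_wpM2l X0 h1.
have h3 : (128 * M + 64) * nrm2 X <= (128 * M + 64) * ((2^-1) ^+ 2 * nrm2 Y) by lra.
have p0 : 0 < 128 * M + 64 by have := M_ge0; lra.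
by move: h3; rewrite (ler_pM2l p0).
Qed.

(* Minty's trick: [v 0] is null, so [u 0 - u0] is orthogonal to the domain. *)
Lemma mild_initial : nrm (u 0) <= nrm u0.
Proof.
pose F := u 0 - u0.
have rip_v0 z : rip z (v 0) = 0.
  have A := rip_le z (v 0); have B := rip_le (- z) (v 0).
  by rewrite v0_null mulr0 ?ripNl in A B; lra.
have orth y G : Gr y G -> rip F y = 0.
  (* As [v 0] is null, dissipativity at [t v 0 + y] is affine in [t]; it holds for every real [t],
     so its slope must vanish. *)
  move=> yG; have H t : rip G y + t * rip F y <= 0.
    have := Gr_dissipative (Gr_lin t%:C v0_graph yG).
    rewrite -/(rscale t _) -/(rscale t _) -/F ripDl !ripDr !ripZl !ripZr !rip_v0.
    by rewrite !mulr0; lra.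
  apply/eqP; case: eqVneq => // nz.
  have := H ((1 - rip G y) / rip F y); rewrite divfK //; lra.
(* Increments at time 0 lie in the domain and, divided by [d], tend to [u 0]. Thus F is orthogonal
   to [u 0] as well, and Pythagoras concludes. *)
have Fu : rip F (u 0) = 0.
  apply/eqP; rewrite -normr_le0; apply: ler_addgt0 => e1 e1_gt0.
  rewrite add0r; pose e := e1 / (nrm F + 1).
  have n1 : 0 < nrm F + 1 by rewrite ltr_wpDl // nrm_ge0.
  have e_gt0 : 0 < e by rewrite divr_gt0.
  have ee : e * (nrm F + 1) = e1 by rewrite divfK // gt_eqF.
  have [d1 d10 H1] := increment_approx (lexx 0) e_gt0.
  pose d := d1 / 2; have d0 : 0 < d by rewrite /d; lra.
  have dd : d < d1 by rewrite /d; lra.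
  have A := H1 d d0 dd.
  have B : rip F (increment d 0) = 0.
    by apply: orth (u (0 + d) - u 0) _; apply: v_graph; lra.
  set z := increment d 0 - _ in A.
  have C : rip F z = - (d * rip F (u 0)) by rewrite /z ripDr ripNr ripZr B sub0r.
  have D1 := rip_le F z; have D2 := rip_le (- F) z.
  rewrite ripNl nrmN in D2.
  have K : nrm F * nrm z <= nrm F * (d * e) by rewrite ler_wpM2l ?nrm_ge0.
  have K2 : nrm F * e <= e1 by rewrite -ee mulrDr mulr1 mulrC lerDl ltW.
  rewrite -(ler_pM2l d0) -[X in X * `|_|](gtr0_norm d0) -normrM.
  have K3 : nrm F * (d * e) <= d * e1 by rewrite mulrCA ler_wpM2l // ltW.
  by rewrite ler_norml; apply/andP; split; lra.
rewrite -ler_sqr ?nnegrE ?nrm_ge0 // !sqr_nrm.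
have -> : u0 = u 0 + - F by rewrite /F opprB addrC subrK.
by rewrite nrm2D nrm2N ripNr [rip (u 0) F]ripC Fu; have := nrm2_ge0 F; lra.
Qed.

Lemma mild_geometric n : nrm (u (n%:R * halving_time)) <= 2^-1 ^+ n * nrm u0.
Proof.
elim: n => [|n IH]; first by rewrite mul0r expr0 mul1r; exact: mild_initial.
have T0 := halving_time_gt0.
rewrite -natr1 mulrDl mul1r exprS -mulrA.
apply: le_trans (mild_halving _) _; first by rewrite mulr_ge0 // ltW.
by rewrite ler_wpM2l.
Qed.

Theorem mild_exponential_decay t : 0 <= t ->
  nrm2 (u t) <= 2 * expR (- (ln 2 / halving_time) * t) * nrm2 u0.
Proof.
move=> t0; have T0 := halving_time_gt0; set T := halving_time in T0 *.
pose n := Num.truncn (t / T).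
have tT : 0 <= t / T by rewrite divr_ge0 // ltW.
have nt : n%:R * T <= t by rewrite -ler_pdivlMr // truncn_le.
have tn : t < n.+1%:R * T by rewrite -ltr_pdivrMr //; exact: truncnS_gt.
have A : nrm (u t) <= 2^-1 ^+ n * nrm u0.
  apply: le_trans (mild_geometric n); apply: mild_contraction => //.
  by rewrite mulr_ge0 // ltW.
have {}A : nrm2 (u t) <= 2^-1 ^+ n * nrm2 u0.
  rewrite -!sqr_nrm; apply: (@le_trans _ _ ((2^-1 ^+ n * nrm u0) ^+ 2)).
    by rewrite ler_sqr ?nnegrE ?mulr_ge0 ?exprn_ge0 ?nrm_ge0.
  (* Squaring gives the factor 4^-n, of which only 2^-n is kept. *)
  rewrite exprMn ler_wpM2r ?sqr_ge0 // expr2 ler_piMr ?exprn_ge0 //.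
  by rewrite exprn_ile1 //; lra.
apply: le_trans A _; rewrite ler_wpM2r ?nrm2_ge0 //.
(* The factor 2 pays for rounding t / T down to [n]. *)
have -> : 2^-1 ^+ n = 2 * 2^-1 ^+ n.+1 :> R by rewrite exprS mulrA divff ?mul1r.
rewrite ler_wpM2l //.
have -> : 2^-1 = expR (- ln 2) :> R by rewrite expRN lnK // posrE.
rewrite -expRM_natl ler_expR.
have l0 : 0 <= ln 2 :> R by rewrite ln_ge0 //; lra.
have : ln 2 / T * t <= ln 2 / T * (n.+1%:R * T).
  by apply: ler_wpM2l; [rewrite divr_ge0 // ltW|exact: ltW].
by rewrite mulrCA divfK ?lt0r_neq0 // mulNr mulrN lerN2.
Qed.

End mild.

End dissipative_graph.


End semi_inner_product.

(** * The energy space of the network and the graph of the operator *)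

Section network_space.
Context {R : realType} (N : nat).
Local Open Scope classical_set_scope.
Local Open Scope complex_scope.
Local Open Scope ring_scope.
Local Notation mu := (@lebesgue_measure R).
Local Notation Re := (@complex.Re R).
Local Notation Im := (@complex.Im R).
Local Notation field := ('I_N -> R -> R[i]).
Implicit Types (a b : R) (f g h : R -> R[i]).

Definition cintg a b f : Prop :=
  intg a b (fun x => Re (f x)) /\ intg a b (fun x => Im (f x)).

Lemma eq_cint a b f g : (forall x, a < x < b -> f x = g x) -> cint a b f = cint a b g.
Proof.
by move=> fg; congr (_ +i* _); apply: eq_itg => x /fg ->.
Qed.

Lemma cintD a b f g : cintg a b f -> cintg a b g ->
  cint a b (fun x => f x + g x) = cint a b f + cint a b g.
Proof.
move=> [f1 f2] [g1 g2]; rewrite /cint -!/(itg _ _ _).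
rewrite (@eq_itg _ _ _ _ (fun x => Re (f x) + Re (g x))); last first.
  by move=> x _; case: (f x); case: (g x).
rewrite (@eq_itg _ _ _ (fun x => Im (f x + g x)) (fun x => Im (f x) + Im (g x))); last first.
  by move=> x _; case: (f x); case: (g x).
by rewrite !itgD.
Qed.

Lemma cintZ a b (c : R[i]) f : cintg a b f -> cint a b (fun x => c * f x) = c * cint a b f.
Proof.
case: c => u v [f1 f2]; rewrite /cint -!/(itg _ _ _).
rewrite (@eq_itg _ _ _ _ (fun x => u * Re (f x) - v * Im (f x))); last first.
  by move=> x _; case: (f x).
rewrite (@eq_itg _ _ _ (fun x => Im _) (fun x => u * Im (f x) + v * Re (f x))); last first.
  by move=> x _; case: (f x).
rewrite itgB ?itgD; try exact: intgZ.
by rewrite !itgZ.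
Qed.

Lemma cint_conj a b f : cintg a b f -> cint a b (fun x => (f x)^*) = (cint a b f)^*.
Proof.
move=> [f1 f2]; rewrite /cint -!/(itg _ _ _) /=.
rewrite (@eq_itg _ _ _ _ (fun x => Re (f x))); last by move=> x _; case: (f x).
rewrite (@eq_itg _ _ _ (fun x => Im _) (fun x => - Im (f x))); last first.
  by move=> x _; case: (f x).
by rewrite itgN.
Qed.

Lemma cintg_mulC a b f g : L2 a b f -> L2 a b g -> cintg a b (fun x => f x * (g x)^*).
Proof.
move=> /L2P[f1 f2] /L2P[g1 g2]; split.
  have := intgD (L2r_mul f1 g1) (L2r_mul f2 g2).
  congr (intg _ _ _); apply/funext => x; case: (f x) => ? ?; case: (g x) => ? ? /=; ring.
have := intgB (L2r_mul f2 g1) (L2r_mul f1 g2).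
congr (intg _ _ _); apply/funext => x; case: (f x) => ? ?; case: (g x) => ? ? /=; ring.
Qed.

Definition inHb : {pred field} := fun u => `[< inH u >].

Lemma inHP (u : field) : reflect (inH u) (u \in inHb).
Proof. exact: asboolP. Qed.

Lemma L2_lin a b (c : R[i]) f g : L2 a b f -> L2 a b g -> L2 a b (fun x => c * f x + g x).
Proof.
case: c => u v /L2P[f1 f2] /L2P[g1 g2]; apply/L2P; split.
  have := L2rD (L2rB (L2rZ u f1) (L2rZ v f2)) g1.
  by congr (L2r _ _ _); apply/funext => x; case: (f x); case: (g x).
have := L2rD (L2rD (L2rZ u f2) (L2rZ v f1)) g2.
by congr (L2r _ _ _); apply/funext => x; case: (f x); case: (g x).
Qed.

Lemma L20 a b : L2 a b (fun=> 0).
Proof. by apply/L2P; split; exact: L2r_cst. Qed.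

Lemma inH_submod : submod_closed inHb.
Proof.
split; first by apply/inHP => j; exact: L20.
by move=> c u v /inHP Hu /inHP Hv; apply/inHP => j; exact: L2_lin (Hu j) (Hv j).
Qed.

HB.instance Definition _ := GRing.isSubmodClosed.Build R[i] field inHb inH_submod.

Record Hsp := MkHsp { hval :> field; _ : hval \in inHb }.
HB.instance Definition _ := [isSub for hval].
HB.instance Definition _ := [Choice of Hsp by <:].
HB.instance Definition _ := [SubChoice_isSubLmodule of Hsp by <:].

Implicit Types (x y z F G : Hsp) (j k : 'I_N).

Lemma HspP x j : L2 j%:R j.+1%:R (x j).
Proof. by case: x => u /= /inHP. Qed.

Lemma hvalD x y j (t : R) : (x + y) j t = x j t + y j t.
Proof. by []. Qed.

Lemma hvalB x y j (t : R) : (x - y) j t = x j t - y j t.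
Proof. by []. Qed.

Lemma hvalZ (c : R[i]) x j (t : R) : (c *: x) j t = c * x j t.
Proof. by []. Qed.

Definition ipH x y : R[i] := innerH x y.

Lemma ipHDl x y z : ipH (x + y) z = ipH x z + ipH y z.
Proof.
rewrite /ipH /innerH -big_split; apply: eq_bigr => j _ /=.
rewrite -cintD; try exact: cintg_mulC (HspP _ _) (HspP _ _).
by congr (cint _ _ _); apply/funext => t; exact: mulrDl.
Qed.

Lemma ipHZl (c : R[i]) x y : ipH (c *: x) y = c * ipH x y.
Proof.
rewrite /ipH /innerH mulr_sumr; apply: eq_bigr => j _ /=.
rewrite -cintZ; last exact: cintg_mulC (HspP _ _) (HspP _ _).
by congr (cint _ _ _); apply/funext => t; exact/esym/mulrA.
Qed.

Lemma ipHC x y : ipH y x = (ipH x y)^*.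
Proof.
rewrite /ipH /innerH rmorph_sum; apply: eq_bigr => j _ /=.
rewrite -cint_conj; last exact: cintg_mulC (HspP _ _) (HspP _ _).
congr (cint _ _ _); apply/funext => t.
by case: (x j t) => a b; case: (y j t) => c d /=; congr (_ +i* _); ring.
Qed.

Lemma Re_sumN (a : 'I_N -> R[i]) : Re (\sum_(j < N) a j) = \sum_(j < N) Re (a j).
Proof. exact: Re_sum. Qed.

Lemma rip_itg x y : rip ipH x y = \sum_(j < N) itg j%:R j.+1%:R (fun t =>
  Re (x j t) * Re (y j t) + Im (x j t) * Im (y j t)).
Proof.
rewrite /rip /ipH /innerH Re_sumN; apply: eq_bigr => j _ /=.
apply: eq_itg => t _; case: (x j t) => ? ?; case: (y j t) => ? ? /=; ring.
Qed.

Lemma innerH_sqnorm (u : field) : Re (innerH u u) = sqnormN u.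
Proof.
rewrite /innerH /sqnormN Re_sumN; apply: eq_bigr => j _ /=.
by apply: eq_itg => t _; case: (u j t) => ? ? /=; ring.
Qed.

Lemma nrm2_sqnorm x : nrm2 ipH x = sqnormN x.
Proof. exact: innerH_sqnorm. Qed.

Lemma ipH_ge0 x : 0 <= Re (ipH x x).
Proof. by rewrite [Re _]nrm2_sqnorm sqnormN_ge0. Qed.

Lemma energy_sqnorm (u : field) : energy u = 2^-1 * sqnormN u.
Proof.
congr (_ * _); apply: eq_bigr => j _; apply: eq_itg => t _.
by case: (u j t) => a b /=; rewrite sqr_sqrtr // addr_ge0 ?sqr_ge0.
Qed.

Variable rho : 'I_N -> R.

(** The graph of the operator up to almost everywhere equality. [opA] depends on representatives
    chosen by [wderiv] and is not pointwise linear, whereas this relation is stable under linear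
    combinations. *)
Definition graph x F : Prop := exists p q s, [/\ elastic rho p q s,
  forall j, ae_eq_on j%:R j.+1%:R (x j) (p j) &
  forall j, ae_eq_on j%:R j.+1%:R (F j) (fun t => - ('i)%C * (rho j)%:C * s j t)].

Lemma cac_lin a b (c : R[i]) f g f' g' : a <= b -> cac a b f f' -> cac a b g g' ->
  cac a b (fun t => c * f t + g t) (fun t => c * f' t + g' t).
Proof.
move=> ab; case: c => u v [f1 f2] [g1 g2]; split.
  have := acD (acD (acZ u f1) (acZ (- v) f2)) g1.
  apply: eq_ac => // t _.
    by case: (f t) => ? ?; case: (g t) => ? ? /=; ring.
  by case: (f' t) => ? ?; case: (g' t) => ? ? /=; ring.
have := acD (acD (acZ u f2) (acZ v f1)) g2.
apply: eq_ac => // t _.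
  by case: (f t) => ? ?; case: (g t) => ? ? /=; ring.
by case: (f' t) => ? ?; case: (g' t) => ? ? /=; ring.
Qed.

Lemma unit_le j : j%:R <= j.+1%:R :> R.
Proof. by rewrite ler_nat. Qed.

Lemma elastic_lin (c : R[i]) (p q s p' q' s' : field) :
  elastic rho p q s -> elastic rho p' q' s' ->
  elastic rho (fun j t => c * p j t + p' j t) (fun j t => c * q j t + q' j t)
    (fun j t => c * s j t + s' j t).
Proof.
move=> E E'; split.
- by move=> j; exact: cac_lin (unit_le j) (elastic_dp E j) (elastic_dp E' j).
- by move=> j; exact: cac_lin (unit_le j) (elastic_dq E j) (elastic_dq E' j).
- by move=> j; exact: L2_lin (elastic_L2 E j) (elastic_L2 E' j).
- move=> j j0; rewrite !mulrDr (elastic_left E' j0) mulrCA (elastic_left E j0).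
  by rewrite mulrCA.
- by move=> j jN; rewrite (elastic_right E jN) (elastic_right E' jN) mulr0 addr0.
- by move=> j k jk; rewrite (elastic_p_joint E jk) (elastic_p_joint E' jk).
- move=> j k jk; rewrite !mulrDr (elastic_q_joint E' jk) mulrCA (elastic_q_joint E jk).
  by rewrite mulrCA.
Qed.

Lemma graph_lin (c : R[i]) x F y G : graph x F -> graph y G ->
  graph (c *: x + y) (c *: F + G).
Proof.
move=> [p [q [s [E xp Fs]]]] [p' [q' [s' [E' yp Gs]]]].
exists (fun j t => c * p j t + p' j t), (fun j t => c * q j t + q' j t),
  (fun j t => c * s j t + s' j t); split.
- exact: elastic_lin.
- by move=> j; apply: ae_mono (ae_and (xp j) (yp j)) => t _ [Ex Ey]; rewrite hvalD hvalZ Ex Ey.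
- move=> j; apply: ae_mono (ae_and (Fs j) (Gs j)) => t _ [EF EG].
  by rewrite hvalD hvalZ EF EG mulrDr [c * (_ * _)]mulrCA.
Qed.

Lemma cac0 a b : cac a b (fun=> 0) (fun=> 0).
Proof. by split; exact: ac_cst. Qed.

Lemma graph0 : graph 0 0.
Proof.
exists (fun _ _ => 0), (fun _ _ => 0), (fun _ _ => 0); split.
- split; try (by move=> *; rewrite !mulr0); try (by move=> *; exact: cac0); try by [].
  by move=> j; exact: L20.
- by move=> j; apply: aeW => t _.
- by move=> j; apply: aeW => t _; rewrite mulr0.
Qed.

Lemma sqnorm_ae a b f g : L2 a b f -> L2 a b g -> ae_eq_on a b f g ->
  sqnorm a b f = sqnorm a b g.
Proof.
move=> [f1 f2 _] [g1 g2 _] fg; apply: eq_itg_ae.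
- by apply: ae_mono fg => t _ ->.
- by apply: measurable_funD; exact: measurable_funX.
- by apply: measurable_funD; exact: measurable_funX.
Qed.

(** At [beta = 0] the residual is [- F] almost everywhere, so [trace_identity] reads Re <F, x> = -
    |p(0)|^2. *)
Lemma graph_dissipative x F : graph x F -> rip ipH F x <= 0.
Proof.
move=> [p [q [s [E xp Fs]]]].
have [N0|N0] := posnP N.
  by rewrite rip_itg big1 // => -[n hn]; exfalso; rewrite N0 in hn.
have := trace_identity 0 E (erefl : Ordinal N0 = 0%N :> nat).
have -> : rip ipH F x = - \sum_(j < N) itg j%:R j.+1%:R (fun t =>
    Re (residN rho 0 p s j t) * Re (p j t) + Im (residN rho 0 p s j t) * Im (p j t)).
  rewrite rip_itg -sumrN; apply: eq_bigr => j _.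
  have Lp := cac_L2 (elastic_dp E j).
  have /L2P[p1 p2] := Lp; have /L2P[r1 r2] := elastic_resid_L2 0 j E.
  have /L2P[x1 x2] := HspP x j; have /L2P[F1 F2] := HspP F j.
  have I1 := intgD (L2r_mul r1 p1) (L2r_mul r2 p2).
  have I2 := intgD (L2r_mul F1 x1) (L2r_mul F2 x2).
  rewrite -itgN //; apply: eq_itg_ae; last first.
  - exact: intg_measurable (intgN I1).
  - exact: intg_measurable I2.
  apply: ae_mono (ae_and (xp j) (Fs j)) => t _ [-> ->].
  by rewrite /residN /resid; case: (s j t) => ? ?; case: (p j t) => ? ? /=; ring.
by move=> <-; rewrite oppr_le0 addr_ge0 ?sqr_ge0.
Qed.

Lemma graph_resolvent (M : R) (beta : R) x F :
  (forall p q s, elastic rho p q s -> sqnormN p <= M * sqnormN (residN rho beta p s)) ->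
  graph x F -> nrm2 ipH x <= M * nrm2 ipH ((0 +i* beta) *: x - F).
Proof.
move=> HM [p [q [s [E xp Fs]]]]; rewrite !nrm2_sqnorm.
have -> : sqnormN x = sqnormN p.
  by apply: eq_bigr => j _; apply: sqnorm_ae (xp j); [exact: HspP|exact: cac_L2 (elastic_dp E j)].
have -> : sqnormN ((0 +i* beta) *: x - F : Hsp) = sqnormN (residN rho beta p s).
  apply: eq_bigr => j _; apply: sqnorm_ae; [exact: HspP|exact: elastic_resid_L2 E|].
  apply: ae_mono (ae_and (xp j) (Fs j)) => t _ [Ex EF].
  rewrite hvalB hvalZ Ex EF /residN /resid.
  case: (s j t) => ? ?; case: (p j t) => ? ? /=.
  by apply/eqP; rewrite eq_complex /=; apply/andP; split; apply/eqP; ring.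
exact: HM E.
Qed.

Lemma domA_elastic (w : field) : domA rho w ->
  elastic rho (bval w) (bval (dx w)) (dx (dx w)) /\
  forall j, ae_eq_on j%:R j.+1%:R (w j) (bval w j).
Proof.
move=> [H2w left right pj qj].
have lt j : j%:R < j.+1%:R :> R by rewrite ltr_nat.
have K j := H2_crep (lt j) (H2w j).
by split=> [|j]; [split=> // j|]; have [] := K j.
Qed.

(** * Mild solutions as curves in the energy space *)

Section mild_solutions.
Variables (u0 : field) (u : R -> field).
Hypothesis u0H : inH u0.
Hypothesis u_mild : mild_solution rho u0 u.

(** The default 0 makes the curve total: at negative times a mild solution is unconstrained and may
    leave H. *)
Definition toH (w : field) : Hsp := insubd 0 w.

Lemma toHK (w : field) : inH w -> hval (toH w) = w.
Proof. by move=> /inHP Hw; rewrite /toH val_insubd Hw. Qed.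

Let uu t : Hsp := toH (u t).

Lemma uuK (t : R) : 0 <= t -> hval (uu t) = u t.
Proof. by move=> t0; apply: toHK; have [+ _ _] := u_mild; exact. Qed.

Lemma integral_choice : exists v : R -> Hsp, forall t : R, 0 <= t ->
  [/\ forall x, ipH (v t) x = cint 0 t (fun r => ipH (uu r) x), domA rho (v t) &
      eqH (u t) (fun j r => u0 j r + opA rho (v t) j r)].
Proof.
have [_ _ H] := u_mild.
have /choice[v Hv] (t : R) : exists v : Hsp, 0 <= t ->
  [/\ forall x, ipH v x = cint 0 t (fun r => ipH (uu r) x), domA rho v &
      eqH (u t) (fun j r => u0 j r + opA rho v j r)].
  have [t0|t0] := leP 0 t; last by exists 0.
  have [w [[wH wI] wD wE]] := H t t0; exists (toH w) => _; rewrite (toHK wH); split=> // x.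
  rewrite /ipH (toHK wH) wI; last by case: (x) => y /= /inHP.
  by apply: eq_cint => r /andP[/ltW r0 _]; rewrite -(uuK r0).
by exists v.
Qed.

Lemma nrm_normH x y : nrm ipH (x - y) = normH (fun j t => x j t - y j t).
Proof. by []. Qed.

Lemma uu_continuous (t e : R) : 0 <= t -> 0 < e -> exists2 d : R, 0 < d &
  forall s : R, 0 <= s -> `|s - t| < d -> nrm ipH (uu s - uu t) < e.
Proof.
move=> t0 e0; have [_ + _] := u_mild.
move=> /(_ t t0) /cvgrPdist_lt /(_ e e0); rewrite near_withinE => /nbhs_ballP[d /= d0 Hd].
exists d => // s s0 st; have := Hd s; rewrite -ball_normE /= distrC => /(_ st s0).
rewrite sub0r normrN nrm_normH !uuK // => /(le_lt_trans (ler_norm _)).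
by [].
Qed.

(** The source of integrability for the tested curve, which [integralH] does not state. *)
Lemma ipuu_continuous (T : R) x :
  {within `[0, T], continuous (fun r : R => rip ipH (uu r) x)}.
Proof.
apply/subspace_continuousP => t /=; rewrite in_itv /= => /andP[t0 tT].
apply/cvgrPdist_lt => e e_gt0.
have n1 : 0 < nrm ipH x + 1 by rewrite ltr_wpDl // sqrtr_ge0.
have [d d0 Hd] := uu_continuous t0 (divr_gt0 e_gt0 n1).
rewrite near_withinE; apply: filterS (nbhsx_ballx t d d0) => s ts /=.
rewrite in_itv /= => /andP[s0 sT].
have {}ts : `|s - t| < d by move: ts; rewrite -ball_normE /= distrC.
have A := Hd s s0 ts.
have C z : rip ipH z x <= nrm ipH z * nrm ipH x.
  exact: (rip_le ipHDl ipHZl ipHC ipH_ge0).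
have E : rip ipH (uu s) x - rip ipH (uu t) x = rip ipH (uu s - uu t) x.
  by rewrite (ripDl ipHDl) (ripNl ipHZl).
have B1 := C (uu s - uu t); have B2 := C (- (uu s - uu t)).
rewrite (ripNl ipHZl) (nrmN ipHZl ipHC) in B2.
rewrite distrC E; apply: (@le_lt_trans _ _ (nrm ipH (uu s - uu t) * nrm ipH x)).
  by rewrite ler_norml lerNl B1 B2.
move: A; rewrite ltr_pdivlMr // mulrDr mulr1; apply: le_lt_trans.
by rewrite lerDl sqrtr_ge0.
Qed.

Lemma intg_ipuu (a b : R) x : 0 <= a -> intg a b (fun r : R => rip ipH (uu r) x).
Proof.
move=> a0; have [ab|ba] := leP 0 b; last first.
  rewrite /intg set_itv_ge ?bnd_simp -?leNgt; first exact: integrable_set0.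
  exact: le_trans (ltW ba) a0.
apply: (@intgS _ 0 b) => //.
apply: (@integrableS _ _ _ mu `[0, b]) => //.
  by apply: subset_itv; rewrite bnd_simp.
apply: continuous_compact_integrable; first exact: segment_compact.
exact: ipuu_continuous.
Qed.

Section primitive.
Variable v : R -> Hsp.
Hypothesis v_spec : forall t : R, 0 <= t ->
  [/\ forall x, ipH (v t) x = cint 0 t (fun r => ipH (uu r) x), domA rho (v t) &
      eqH (u t) (fun j r => u0 j r + opA rho (v t) j r)].

Lemma rip_v (t : R) x : 0 <= t -> rip ipH (v t) x = itg 0 t (fun r => rip ipH (uu r) x).
Proof. by move=> t0; have [H _ _] := v_spec t0; rewrite /rip H. Qed.

(** The error [y] is paired with itself: |y|^2 is the integral of Re <u r - x, y> over [s, t], at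
    most (t - s) c |y|, and |y| is divided out. *)
Lemma v_primitive (s t : R) x (c : R) : 0 <= s -> s <= t ->
  (forall r : R, s <= r -> r <= t -> nrm ipH (uu r - x) <= c) ->
  nrm ipH (v t - v s - rscale (t - s) x) <= (t - s) * c.
Proof.
move=> s0 st H; set y := _ - rscale _ _.
have t0 := le_trans s0 st.
have Iy a b : 0 <= a -> intg a b (fun r : R => rip ipH (uu r) y) by exact: intg_ipuu.
have I2 : intg s t (fun r : R => rip ipH (uu r) y - rip ipH x y).
  by apply: intgB; [exact: Iy|exact: intg_cst].
have E : nrm2 ipH y = itg s t (fun r => rip ipH (uu r) y - rip ipH x y).
  rewrite itgB //; [|exact: Iy|exact: intg_cst].
  rewrite itg_cst // [LHS]/nrm2 {1}/y !(ripDl ipHDl) !(ripNl ipHZl) (ripZl ipHZl).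
  rewrite !rip_v // (@itg_split _ 0 t s) ?s0 //; last exact: Iy.
  by move: (itg 0 s _) (itg s t _) (rip ipH x y) => A B C; ring.
have ub : nrm2 ipH y <= (t - s) * c * nrm ipH y.
  rewrite E; have -> : (t - s) * c * nrm ipH y = itg s t (fun=> c * nrm ipH y).
    by rewrite itg_cst //; ring.
  apply: le_itg => //; first exact: intg_cst.
  move=> r /andP[sr rt]; rewrite -(ripNl ipHZl) -(ripDl ipHDl).
  apply: le_trans (rip_le ipHDl ipHZl ipHC ipH_ge0 _ _) _.
  by rewrite ler_wpM2r ?sqrtr_ge0 // H // ltW.
have n0 : 0 <= nrm ipH y by exact: sqrtr_ge0.
rewrite -(sqr_nrm ipH_ge0) expr2 in ub.
move: n0; rewrite le_eqVlt => /predU1P[<-|n0]; last by rewrite ler_pM2r in ub.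
(* For a null [y] the claim needs 0 <= c, read off from the hypothesis at r = s. *)
rewrite mulr_ge0 ?subr_ge0 //; apply: le_trans (H s (lexx s) st); exact: sqrtr_ge0.
Qed.

Lemma v_graph0 (t : R) : 0 <= t -> graph (v t) (uu t - toH u0).
Proof.
move=> t0; have [_ Dv Ev] := v_spec t0.
have [E wp] := domA_elastic Dv.
exists (bval (v t)), (bval (dx (v t))), (dx (dx (v t))); split => // j.
apply: ae_mono (Ev j) => r _; rewrite hvalB uuK // toHK // => ->.
by rewrite /opA addrAC subrr add0r.
Qed.

Lemma v_graph (s t : R) : 0 <= s -> 0 <= t -> graph (v t - v s) (uu t - uu s).
Proof.
move=> s0 t0; have := graph_lin (-1) (v_graph0 s0) (v_graph0 t0).
rewrite !scaleN1r [- v s + _]addrC; congr (graph _ _).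
by rewrite opprB addrC addrA subrK.
Qed.

Lemma v0_null : nrm ipH (v 0) = 0.
Proof. by rewrite /nrm /nrm2 rip_v // itg_refl sqrtr0. Qed.

End primitive.

End mild_solutions.

End network_space.

Local Open Scope ring_scope.

Theorem theorem5p2 (R : realType) (N : nat) (hN : (1 <= N)%N)
  (rho : 'I_N -> R) (hrho : forall j : 'I_N, 0 < rho j) :
  exists C omega : R, 0 < C /\ 0 < omega /\
    forall u0 : 'I_N -> R -> R[i], inH u0 ->
    forall u : R -> 'I_N -> R -> R[i], mild_solution rho u0 u ->
    forall t : R, 0 < t ->
      energy (u t) <= C * expR (- omega * t) * normH u0 ^+ 2.
Proof.
have [M M0 HM] := resolvent_bound hrho.
(* C = 1 because the factor 2 of [mild_exponential_decay] cancels against the 1/2 of the energy. *)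
exists 1, (ln 2 / halving_time M); split=> //; split.
  by rewrite divr_gt0 ?halving_time_gt0 ?(ltW M0) // ln_gt0 // ltr1n.
move=> u0 u0H u Hu t t0.
have [v Hv] := integral_choice Hu.
have := mild_exponential_decay (@ipHDl R N) (@ipHZl R N) (@ipHC R N) (@ipH_ge0 R N)
  (@graph_lin R N rho) (@graph0 R N rho) (@graph_dissipative R N rho) (ltW M0)
  (fun beta x F => graph_resolvent (HM beta)) (uu_continuous Hu)
  (v_primitive Hu Hv) (v_graph u0H Hu Hv) (v_graph0 u0H Hu Hv (lexx 0))
  (v0_null Hv) (ltW t0).
rewrite !nrm2_sqnorm (uuK Hu (ltW t0)) (toHK u0H).
rewrite /normH sqr_sqrtr innerH_sqnorm ?sqnormN_ge0 // energy_sqnorm mul1r.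
by move: (sqnormN (u t)) (sqnormN u0) (expR _) => A B E; lra.
Qed.
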